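(* Let $\Lambda$ be a (nonempty) finitely aligned $k$-graph and let $R$ be a commutative unital ring. If (1) $R$ is a field, (2) $\Lambda$ is aperiodic and cofinal, and (3) every vertex of $\Lambda$ is reached from a generalized cycle with an entrance, then the Kumjian-Pask algebra $\mathrm{KP}_R(\Lambda)$ is simple and purely infinite.
   Context: $\mathbb{N}$ is the set of non-negative integers and $k\ge 1$ is an integer. $\mathbb{N}^k$ carries pointwise addition and the coordinatewise partial order $\le$; $m\vee n$ is the coordinatewise maximum. **$k$-graphs.** A $k$-graph is a countable small category $\Lambda$ with range and source maps $r,s$, together with a functor $d:\Lambda\to\mathbb{N}^k$ such that whenever $d(\lambda)=m+n$ there are unique $\lambda_1,\lambda_2\in\Lambda$ with $d(\lambda_1)=m$, $d(\lambda_2)=n$, $\lambda=\lambda_1\lambda_2$. Objects (vertices) are identified with the paths of degree $0$; their set is $\Lambda^0$. The composite $\lambda\mu$ is defined iff $s(\lambda)=r(\mu)$. Write $v\Lambda=\{\lambda: r(\lambda)=v\}$, and $v\le w$ if there is $\lambda\in\Lambda$ with $r(\lambda)=v$, $s(\lambda)=w$ (i.e. $v\Lambda w\ne\emptyset$). $\mathrm{MCE}(\mu,\nu)$ is the set of paths $\lambda$ with $d(\lambda)=d(\mu)\vee d(\nu)$ and $\lambda=\mu\alpha=\nu\beta$ for some $\alpha,\beta\in\Lambda$, and $\Lambda^{\min}(\mu,\nu)=\{(\alpha,\beta):\mu\alpha=\nu\beta\in\mathrm{MCE}(\mu,\nu)\}$. $\Lambda$ is finitely aligned if $\Lambda^{\min}(\mu,\nu)$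 is finite (possibly empty) for all $\mu,\nu$. **Exhaustive sets.** $E\subseteq v\Lambda$ is exhaustive if for every $\lambda\in v\Lambda$ there is $\mu\in E$ with $\Lambda^{\min}(\lambda,\mu)\neq\emptyset$. $v\mathrm{FE}(\Lambda)$ is the collection of finite exhaustive sets $E\subseteq v\Lambda\setminus\{v\}$. **Boundary paths.** For $m\in(\mathbb{N}\cup\{\infty\})^k$, $\Omega_{k,m}=\{(p,q)\in\mathbb{N}^k\times\mathbb{N}^k: p\le q\le m\}$ is the $k$-graph with $r(p,q)=(p,p)$, $s(p,q)=(q,q)$, $d(p,q)=q-p$. A boundary path is a degree-preserving functor $x:\Omega_{k,m}\to\Lambda$ such that for all $p\in\mathbb{N}^k$, $p\le m$, and all $E\in x(p,p)\mathrm{FE}(\Lambda)$ there is $\mu\in E$ with $p+d(\mu)\le m$ and $x(p,p+d(\mu))=\mu$. Write $d(x)=m$, $x(n)=x(n,n)$, $r(x)=x(0)$; $\partial\Lambda$ is the set of boundary paths and $v\partial\Lambda=\{x\in\partial\Lambda:r(x)=v\}$. For $n\in\mathbb{N}^k$, $n\le d(x)$, the shift $\sigma^n(x)\in\partial\Lambda$ has degree $d(x)-n$ and $\sigma^n(x)(p,q)=x(n+p,n+q)$. **Cofinal, aperiodic.** $\Lambda$ is cofinal if for every $v\in\Lambda^0$ and $x\in\partial\Lambda$ there is $n\le d(x)$, $n\in\mathbb{N}^k$, with $v\Lambda x(n)\ne\emptyset$. $\Lambda$ is aperiodic if for every $v\in\Lambda^0$ and $m\ne n\in\mathbb{N}^k$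 there is $x\in v\partial\Lambda$ with either $m\vee n\not\le d(x)$ or $\sigma^m(x)\neq\sigma^n(x)$. **Generalized cycles.** A generalized cycle is a pair $(\mu,\nu)$ of distinct paths with $s(\mu)=s(\nu)$, $r(\mu)=r(\nu)$ and $\mathrm{MCE}(\mu\tau,\nu)\neq\emptyset$ for all $\tau\in s(\mu)\Lambda$. An entrance for $(\mu,\nu)$ is a path $\tau\in s(\nu)\Lambda$ with $\mathrm{MCE}(\mu,\nu\tau)=\emptyset$. A vertex $v$ is reached from $(\mu,\nu)$ if $v\le s(\mu)$. **Kumjian-Pask algebra.** For $R$ a commutative unital ring, a Kumjian-Pask $\Lambda$-family in an $R$-algebra is a collection $\{S_\lambda,S_{\lambda^*}:\lambda\in\Lambda\}$ (with $S_{v^*}=S_v$ for $v\in\Lambda^0$) such that: (KP1) $S_vS_w=\delta_{v,w}S_v$ for $v,w\in\Lambda^0$; (KP2) $S_\mu S_\nu=S_{\mu\nu}$ and $S_{\nu^*}S_{\mu^*}=S_{(\mu\nu)^*}$ when $s(\mu)=r(\nu)$; (KP3) $S_{\mu^*}S_\nu=\sum_{(\alpha,\beta)\in\Lambda^{\min}(\mu,\nu)}S_\alpha S_{\beta^*}$ for all $\mu,\nu$; (KP4) $\prod_{\mu\in E}(S_v-S_\mu S_{\mu^*})=0$ for all $v\in\Lambda^0$, $E\in v\mathrm{FE}(\Lambda)$. $\mathrm{KP}_R(\Lambda)$ is the universal $R$-algebra generated by a Kumjian-Pask $\Lambda$-family $\{s_\lambda,s_{\lambda^*}\}$ (not necessarily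 unital). **Purely infinite.** An idempotent $e$ of a ring $A$ is infinite if $eA$ is isomorphic, as a right $A$-module, to a proper direct summand of itself. $A$ is purely infinite if every nonzero right ideal of $A$ contains an infinite idempotent. *)

(* Defs.v *)
From HB Require Import structures.
From mathcomp Require Import all_boot all_algebra finmap.
From mathcomp Require Import boolp classical_sets cardinality.

Set Implicit Arguments.
Unset Strict Implicit.
Unset Printing Implicit Defensive.

Import GRing.Theory.

Local Open Scope classical_set_scope.
Local Open Scope ring_scope.

Definition Nk (k : nat) := {ffun 'I_k -> nat}.

Definition Nk_le (k : nat) (m n : Nk k) : bool := [forall i, (m i <= n i)%N].

Definition Nk_join (k : nat) (m n : Nk k) : Nk k := [ffun i => maxn (m i) (n i)].

(* Coordinatewise truncated subtraction; only used when n <= m. *)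
Definition Nk_sub (k : nat) (m n : Nk k) : Nk k := [ffun i => (m i - n i)%N].

(* (N u {oo})^k, where None stands for oo. *)
Definition xNk (k : nat) := {ffun 'I_k -> option nat}.

Definition xNk_ge (k : nat) (m : xNk k) (p : Nk k) : bool :=
  [forall i, if m i is Some a then (p i <= a)%N else true].

Definition xNk_sub (k : nat) (m : xNk k) (n : Nk k) : xNk k :=
  [ffun i => omap (fun a => (a - n i)%N) (m i)].

(* A countable small category with a degree functor and unique factorisation.
   [kcomp l m] is the composite l m (apply m first, then l); it is meaningful
   only when [ksrc l = krng m], and its other values are unconstrained and
   never used. *)
Record kgraph (k : nat) := KGraph {
  kobj : countType;
  kmor :> countType;
  krng : kmor -> kobj;
  ksrc : kmor -> kobj;
  kid : kobj -> kmor;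
  kcomp : kmor -> kmor -> kmor;
  kdeg : kmor -> Nk k;
  krng_id : forall v, krng (kid v) = v;
  ksrc_id : forall v, ksrc (kid v) = v;
  krng_comp : forall l m, ksrc l = krng m -> krng (kcomp l m) = krng l;
  ksrc_comp : forall l m, ksrc l = krng m -> ksrc (kcomp l m) = ksrc m;
  kcomp1l : forall l, kcomp (kid (krng l)) l = l;
  kcompl1 : forall l, kcomp l (kid (ksrc l)) = l;
  kcompA : forall l m n, ksrc l = krng m -> ksrc m = krng n ->
    kcomp l (kcomp m n) = kcomp (kcomp l m) n;
  kdeg_id : forall v, kdeg (kid v) = 0;
  kdeg_comp : forall l m, ksrc l = krng m ->
    kdeg (kcomp l m) = kdeg l + kdeg m;
  kfactor : forall l (m n : Nk k), kdeg l = m + n ->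
    exists! p : kmor * kmor,
      [/\ ksrc p.1 = krng p.2, kcomp p.1 p.2 = l, kdeg p.1 = m & kdeg p.2 = n]
}.

(* The identification of the vertices with the paths of degree 0. *)
Lemma kdeg0E (k : nat) (L : kgraph k) (l : L) :
  kdeg l = 0 <-> l = kid (krng l).
Proof.
split=> [d0|->]; last exact: kdeg_id.
have [|p [_ up]] := @kfactor _ L l 0 0; first by rewrite addr0.
have /(congr1 fst) /= <- : p = (kid (krng l), l).
  by apply: up; split; rewrite /= ?ksrc_id ?kcomp1l ?kdeg_id.
have /(congr1 fst) // : p = (l, kid (ksrc l)).
by apply: up; split; rewrite /= ?krng_id ?kcompl1 ?kdeg_id.
Qed.

Section KGraphs.
Context {k : nat} (L : kgraph k).
Implicit Types (v w : kobj L) (l m n a b t : L).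

Definition reaches v w : Prop := exists l, krng l = v /\ ksrc l = w.

Definition Lmin m n : set (L * L) :=
  [set ab | [/\ ksrc m = krng ab.1, ksrc n = krng ab.2,
                kcomp m ab.1 = kcomp n ab.2 &
                kdeg (kcomp m ab.1) = Nk_join (kdeg m) (kdeg n)]].

Definition MCE m n : set L :=
  [set l | kdeg l = Nk_join (kdeg m) (kdeg n) /\
     exists a b, [/\ ksrc m = krng a, ksrc n = krng b,
                     l = kcomp m a & l = kcomp n b]].

Definition finitely_aligned : Prop := forall m n, finite_set (Lmin m n).

Definition exhaustive v (E : set L) : Prop :=
  forall l, krng l = v -> exists2 m, E m & Lmin l m !=set0.

Definition FE v (E : {fset L}) : Prop :=
  [/\ forall m, m \in E -> krng m = v /\ m <> kid v
    & exhaustive v [set` E]].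

(* Raw data of a functor from Omega_{k,m} to L: m, the images x(p) of the
   objects (p, p) and the images x(p, q) of the morphisms (p, q).  Only the
   values at p <= q <= m are meaningful, see [is_graph_morphism] and [xpath_eq]. *)
Record xpath := XPath {
  xdeg : xNk k;
  xobj : Nk k -> kobj L;
  xmor : Nk k -> Nk k -> L
}.

Definition xpath_eq (x y : xpath) : Prop :=
  [/\ xdeg x = xdeg y,
      forall p, xNk_ge (xdeg x) p -> xobj x p = xobj y p
    & forall p q, Nk_le p q -> xNk_ge (xdeg x) q -> xmor x p q = xmor y p q].

Definition is_graph_morphism (x : xpath) : Prop :=
  [/\ forall p, xNk_ge (xdeg x) p -> xmor x p p = kid (xobj x p),
      forall p q, Nk_le p q -> xNk_ge (xdeg x) q ->
        [/\ krng (xmor x p q) = xobj x p, ksrc (xmor x p q) = xobj x q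
          & kdeg (xmor x p q) = Nk_sub q p]
    & forall p q u, Nk_le p q -> Nk_le q u -> xNk_ge (xdeg x) u ->
        xmor x p u = kcomp (xmor x p q) (xmor x q u)].

Definition boundary_path (x : xpath) : Prop :=
  is_graph_morphism x /\
  forall p, xNk_ge (xdeg x) p -> forall E, FE (xobj x p) E ->
    exists m, [/\ m \in E, xNk_ge (xdeg x) (p + kdeg m)
                & xmor x p (p + kdeg m) = m].

(* The shift of x by n, only used when n <= d(x). *)
Definition xshift (n : Nk k) (x : xpath) : xpath :=
  XPath (xNk_sub (xdeg x) n) (fun p => xobj x (n + p))
        (fun p q => xmor x (n + p) (n + q)).

Definition cofinal : Prop :=
  forall v (x : xpath), boundary_path x ->
    exists2 n : Nk k, xNk_ge (xdeg x) n & reaches v (xobj x n).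

Definition aperiodic : Prop :=
  forall v (m n : Nk k), m <> n ->
    exists x : xpath, [/\ boundary_path x, xobj x 0 = v &
      ~~ xNk_ge (xdeg x) (Nk_join m n) \/ ~ xpath_eq (xshift m x) (xshift n x)].

Definition generalized_cycle m n : Prop :=
  [/\ m <> n, ksrc m = ksrc n, krng m = krng n
    & forall t, krng t = ksrc m -> MCE (kcomp m t) n !=set0].

Definition entrance m n t : Prop := krng t = ksrc n /\ MCE m (kcomp n t) = set0.

Definition reached_from v m n : Prop := reaches v (ksrc m).

End KGraphs.

HB.mixin Record Lmodule_isNalgebra (R : comPzRingType) A of GRing.Lmodule R A := {
  nmul : A -> A -> A;
  nmulA : associative nmul;
  nmulDl : left_distributive nmul +%R;
  nmulDr : right_distributive nmul +%R;
  nscaleAl : forall (c : R) (x y : A), c *: nmul x y = nmul (c *: x) y;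
  nscaleAr : forall (c : R) (x y : A), c *: nmul x y = nmul x (c *: y)
}.

#[short(type="nalgType")]
HB.structure Definition Nalgebra (R : comPzRingType) :=
  { A of Lmodule_isNalgebra R A & GRing.Lmodule R A }.

Notation "x ** y" := (nmul x y) (at level 40, left associativity) : ring_scope.

(* Product of a nonempty list; the value at [::] is irrelevant. *)
Definition nprod (R : comPzRingType) (A : nalgType R) (s : seq A) : A :=
  if s is x :: s' then foldl nmul x s' else 0.

Definition nalg_hom (R : comPzRingType) (A B : nalgType R) (f : A -> B) : Prop :=
  [/\ forall x y, f (x + y) = f x + f y, forall (c : R) x, f (c *: x) = c *: f x
    & forall x y, f (x ** y) = f x ** f y].

Section Ideals.
Context {R : comPzRingType} (A : nalgType R).

(* Ideals are those of the underlying ring: closure under scalars is not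
   required. *)
Definition right_ideal (I : set A) : Prop :=
  [/\ I 0, forall x y, I x -> I y -> I (x - y) & forall x a, I x -> I (x ** a)].

Definition ideal (I : set A) : Prop :=
  right_ideal I /\ forall a x, I x -> I (a ** x).

Definition simple_ring : Prop :=
  (exists x y : A, x ** y <> 0) /\
  forall I : set A, ideal I -> I = [set 0] \/ I = setT.

Definition right_iso (M N : set A) : Prop :=
  exists f : A -> A,
    [/\ forall x y, M x -> M y -> f (x + y) = f x + f y,
        forall x a, M x -> f (x ** a) = f x ** a,
        forall x y, M x -> M y -> f x = f y -> x = y
      & f @` M = N].

Definition direct_sum (M N P : set A) : Prop :=
  [/\ right_ideal N, right_ideal P, N `&` P = [set 0]
    & M = [set x + y | x in N & y in P]].

Definition infinite_idempotent (e : A) : Prop :=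
  e ** e = e /\
  let eA := [set e ** a | a in setT] in
  exists N P : set A, [/\ direct_sum eA N P, N <> eA & right_iso eA N].

Definition purely_infinite : Prop :=
  forall I : set A, right_ideal I -> I <> [set 0] ->
    exists2 e, I e & infinite_idempotent e.

End Ideals.

(* [S l] is S_l and [T l] is S_{l^*}.  Given (KP1)-(KP3), the factors of the
   product in (KP4) commute, so the order in which E is enumerated is
   immaterial. *)
Definition kp_family (R : comPzRingType) (k : nat) (L : kgraph k)
    (A : nalgType R) (S T : L -> A) : Prop :=
  (forall v, T (kid v) = S (kid v)) /\
  [/\ forall v w, S (kid v) ** S (kid w) = if v == w then S (kid v) else 0,
      forall m n, ksrc m = krng n ->
        S m ** S n = S (kcomp m n) /\ T n ** T m = T (kcomp m n),
      forall m n, T m ** S n = \sum_(ab <- fset_set (Lmin m n)) S ab.1 ** T ab.2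
    & forall v E, FE v E ->
        nprod [seq S (kid v) - S m ** T m | m <- enum_fset E] = 0].

(* The universal algebra is built as formal expressions in the generators,
   two of them being identified when they agree in every Kumjian-Pask family
   of every R-algebra. *)
Inductive kp_term (R : comPzRingType) (k : nat) (L : kgraph k) : Type :=
| KPpath of L
| KPghost of L
| KPzero
| KPadd of kp_term R L & kp_term R L
| KPscale of R & kp_term R L
| KPmul of kp_term R L & kp_term R L.

Arguments KPpath R {k L}.
Arguments KPghost R {k L}.
Arguments KPzero R {k} L.

Fixpoint kp_eval (R : comPzRingType) (k : nat) (L : kgraph k) (A : nalgType R)
    (S T : L -> A) (t : kp_term R L) : A :=
  match t with
  | KPpath l => S l
  | KPghost l => T l
  | KPzero => 0
  | KPadd t u => kp_eval S T t + kp_eval S T u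
  | KPscale c t => c *: kp_eval S T t
  | KPmul t u => kp_eval S T t ** kp_eval S T u
  end.

Definition kp_eqv (R : comPzRingType) (k : nat) (L : kgraph k)
    (t u : kp_term R L) : Prop :=
  forall (A : nalgType R) (S T : L -> A),
    kp_family S T -> kp_eval S T t = kp_eval S T u.

HB.instance Definition _ (R : comPzRingType) (k : nat) (L : kgraph k) :=
  gen_eqMixin (kp_term R L).
HB.instance Definition _ (R : comPzRingType) (k : nat) (L : kgraph k) :=
  gen_choiceMixin (kp_term R L).

Section KumjianPask.
Context (R : comPzRingType) (k : nat) (L : kgraph k).
Implicit Types t u : kp_term R L.

Definition kp_eqvb t u : bool := `[< kp_eqv t u >].

Fact kp_eqvb_refl : reflexive kp_eqvb.
Proof. by move=> t; apply/asboolP => A S T _. Qed.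

Fact kp_eqvb_sym : symmetric kp_eqvb.
Proof. by move=> t u; apply/asboolP/asboolP => h A S T /h ->. Qed.

Fact kp_eqvb_trans : transitive kp_eqvb.
Proof.
by move=> u t w /asboolP h1 /asboolP h2; apply/asboolP => A S T kp;
   rewrite h1 ?h2.
Qed.

Canonical kp_equiv := EquivRel kp_eqvb kp_eqvb_refl kp_eqvb_sym kp_eqvb_trans.

Definition kp_algebra := {eq_quot kp_equiv}%qT.

HB.instance Definition _ := Choice.on kp_algebra.

Definition kp_pi t : kp_algebra := (\pi_(kp_algebra) t)%qT.
Definition kp_repr (x : kp_algebra) : kp_term R L := repr x.

Lemma kp_reprK : cancel kp_repr kp_pi.
Proof. exact: reprK. Qed.

Lemma kp_piP t u : kp_pi t = kp_pi u <-> kp_eqv t u.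
Proof.
by split=> [/eqquotP /asboolP //|h]; apply/eqquotP/asboolP.
Qed.

Lemma kp_repr_pi t : kp_eqv (kp_repr (kp_pi t)) t.
Proof. by apply/kp_piP; rewrite kp_reprK. Qed.

Lemma kp_ind (P : kp_algebra -> Prop) : (forall t, P (kp_pi t)) -> forall x, P x.
Proof. by move=> h x; rewrite -[x]kp_reprK. Qed.

Definition kp_add (x y : kp_algebra) := kp_pi (KPadd (kp_repr x) (kp_repr y)).
Definition kp_scale (c : R) (x : kp_algebra) := kp_pi (KPscale c (kp_repr x)).
Definition kp_opp (x : kp_algebra) := kp_scale (-1) x.
Definition kp_mul (x y : kp_algebra) := kp_pi (KPmul (kp_repr x) (kp_repr y)).

Lemma kp_addE t u : kp_add (kp_pi t) (kp_pi u) = kp_pi (KPadd t u).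
Proof. by apply/kp_piP => A S T kp /=; rewrite !kp_repr_pi. Qed.
Lemma kp_scaleE c t : kp_scale c (kp_pi t) = kp_pi (KPscale c t).
Proof. by apply/kp_piP => A S T kp /=; rewrite !kp_repr_pi. Qed.
Lemma kp_mulE t u : kp_mul (kp_pi t) (kp_pi u) = kp_pi (KPmul t u).
Proof. by apply/kp_piP => A S T kp /=; rewrite !kp_repr_pi. Qed.

Let kpE := (kp_addE, kp_scaleE, kp_mulE).

Fact kp_addA : associative kp_add.
Proof.
elim/kp_ind=> t; elim/kp_ind=> u; elim/kp_ind=> w; rewrite !kpE.
by apply/kp_piP => A S T _ /=; rewrite addrA.
Qed.
Fact kp_addC : commutative kp_add.
Proof.
elim/kp_ind=> t; elim/kp_ind=> u; rewrite !kpE.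
by apply/kp_piP => A S T _ /=; rewrite addrC.
Qed.
Fact kp_add0 : left_id (kp_pi (KPzero R L)) kp_add.
Proof.
by elim/kp_ind=> t; rewrite !kpE; apply/kp_piP => A S T _ /=; rewrite add0r.
Qed.
Fact kp_addN : left_inverse (kp_pi (KPzero R L)) kp_opp kp_add.
Proof.
elim/kp_ind=> t; rewrite /kp_opp !kpE.
by apply/kp_piP => A S T _ /=; rewrite scaleN1r addNr.
Qed.

HB.instance Definition _ := GRing.isZmodule.Build kp_algebra
  kp_addA kp_addC kp_add0 kp_addN.

Fact kp_scaleA a b (x : kp_algebra) :
  kp_scale a (kp_scale b x) = kp_scale (a * b) x.
Proof.
elim/kp_ind: x => t; rewrite !kpE.
by apply/kp_piP => A S T _ /=; rewrite scalerA.
Qed.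
Fact kp_scale1 : left_id 1 kp_scale.
Proof.
by elim/kp_ind=> t; rewrite !kpE; apply/kp_piP => A S T _ /=; rewrite scale1r.
Qed.
Fact kp_scaleDr : right_distributive kp_scale +%R.
Proof.
move=> c; elim/kp_ind=> t; elim/kp_ind=> u; rewrite /GRing.add /= !kpE.
by apply/kp_piP => A S T _ /=; rewrite scalerDr.
Qed.
Fact kp_scaleDl (x : kp_algebra) : {morph kp_scale^~ x : a b / a + b}.
Proof.
move=> a b; elim/kp_ind: x => t; rewrite [in RHS]/GRing.add /= !kpE.
by apply/kp_piP => A S T _ /=; rewrite scalerDl.
Qed.

HB.instance Definition _ := GRing.Zmodule_isLmodule.Build R kp_algebra
  kp_scaleA kp_scale1 kp_scaleDr kp_scaleDl.

Fact kp_mulA : associative kp_mul.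
Proof.
elim/kp_ind=> t; elim/kp_ind=> u; elim/kp_ind=> w; rewrite !kpE.
by apply/kp_piP => A S T _ /=; rewrite nmulA.
Qed.
Fact kp_mulDl : left_distributive kp_mul +%R.
Proof.
elim/kp_ind=> t; elim/kp_ind=> u; elim/kp_ind=> w; rewrite /GRing.add /= !kpE.
by apply/kp_piP => A S T _ /=; rewrite nmulDl.
Qed.
Fact kp_mulDr : right_distributive kp_mul +%R.
Proof.
elim/kp_ind=> t; elim/kp_ind=> u; elim/kp_ind=> w; rewrite /GRing.add /= !kpE.
by apply/kp_piP => A S T _ /=; rewrite nmulDr.
Qed.
Fact kp_scaleAl (c : R) (x y : kp_algebra) : c *: kp_mul x y = kp_mul (c *: x) y.
Proof.
elim/kp_ind: x => t; elim/kp_ind: y => u; rewrite /GRing.scale /= !kpE.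
by apply/kp_piP => A S T _ /=; rewrite nscaleAl.
Qed.
Fact kp_scaleAr (c : R) (x y : kp_algebra) : c *: kp_mul x y = kp_mul x (c *: y).
Proof.
elim/kp_ind: x => t; elim/kp_ind: y => u; rewrite /GRing.scale /= !kpE.
by apply/kp_piP => A S T _ /=; rewrite nscaleAr.
Qed.

HB.instance Definition _ := Lmodule_isNalgebra.Build R kp_algebra
  kp_mulA kp_mulDl kp_mulDr kp_scaleAl kp_scaleAr.

Definition kp_s (l : L) : kp_algebra := kp_pi (KPpath R l).
Definition kp_t (l : L) : kp_algebra := kp_pi (KPghost R l).

Definition kp_lift (A : nalgType R) (S T : L -> A) (x : kp_algebra) : A :=
  kp_eval S T (kp_repr x).

Lemma kp_piD t u : kp_pi (KPadd t u) = kp_pi t + kp_pi u.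
Proof. by rewrite -kp_addE. Qed.
Lemma kp_pi0 : kp_pi (KPzero R L) = 0.
Proof. by []. Qed.
Lemma kp_piZ c t : kp_pi (KPscale c t) = c *: kp_pi t.
Proof. by rewrite -kp_scaleE. Qed.
Lemma kp_piM t u : kp_pi (KPmul t u) = kp_pi t ** kp_pi u.
Proof. by rewrite -kp_mulE. Qed.

Lemma kp_lift_pi (A : nalgType R) (S T : L -> A) t :
  kp_family S T -> kp_lift S T (kp_pi t) = kp_eval S T t.
Proof. by move=> kp; rewrite /kp_lift kp_repr_pi. Qed.

(* [kp_universal_family], [kp_lift_hom], [kp_lift_gen] and [kp_hom_uniq] together
   say that [kp_algebra], with [kp_s] and [kp_t], is the universal R-algebra
   generated by a Kumjian-Pask family. *)

Lemma kp_lift_hom (A : nalgType R) (S T : L -> A) :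
  kp_family S T -> nalg_hom (kp_lift S T).
Proof.
move=> kp; split.
- by elim/kp_ind=> t; elim/kp_ind=> u; rewrite -kp_piD !kp_lift_pi.
- by move=> c; elim/kp_ind=> t; rewrite -kp_piZ !kp_lift_pi.
- by elim/kp_ind=> t; elim/kp_ind=> u; rewrite -kp_piM !kp_lift_pi.
Qed.

Lemma kp_lift_gen (A : nalgType R) (S T : L -> A) : kp_family S T ->
  (forall l, kp_lift S T (kp_s l) = S l) /\ (forall l, kp_lift S T (kp_t l) = T l).
Proof. by move=> kp; split=> l; rewrite kp_lift_pi. Qed.

Lemma kp_hom_uniq (A : nalgType R) (f g : kp_algebra -> A) :
  nalg_hom f -> nalg_hom g ->
  (forall l, f (kp_s l) = g (kp_s l)) -> (forall l, f (kp_t l) = g (kp_t l)) ->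
  f =1 g.
Proof.
move=> [fD fZ fM] [gD gZ gM] eS eT; elim/kp_ind.
elim=> [l|l||t IHt u IHu|c t IHt|t IHt u IHu].
- exact: eS.
- exact: eT.
- by rewrite kp_pi0 -(scale0r 0) fZ gZ !scale0r.
- by rewrite kp_piD fD gD IHt IHu.
- by rewrite kp_piZ fZ gZ IHt.
- by rewrite kp_piM fM gM IHt IHu.
Qed.

(* An identity holds in [kp_algebra] as soon as its images under all the
   [kp_lift] hold. *)
Lemma kp_sep (x y : kp_algebra) :
  (forall (A : nalgType R) (S T : L -> A), kp_family S T ->
     kp_lift S T x = kp_lift S T y) -> x = y.
Proof.
elim/kp_ind: x => t; elim/kp_ind: y => u h; apply/kp_piP => A S T kp.
by rewrite -!kp_lift_pi // h.
Qed.

Lemma kp_lift_nprod (A : nalgType R) (S T : L -> A) (s : seq kp_algebra) :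
  kp_family S T -> kp_lift S T (nprod s) = nprod (map (kp_lift S T) s).
Proof.
move=> kp; have [_ fZ fM] := kp_lift_hom kp.
case: s => [|x s] /=; first by rewrite -(scale0r 0) fZ scale0r.
by elim: s x => //= y s IH x; rewrite IH fM.
Qed.

Lemma kp_universal_family : kp_family kp_s kp_t.
Proof.
have f0 (A : nalgType R) (S T : L -> A) : kp_family S T -> kp_lift S T 0 = 0.
  by move=> kp; have [_ fZ _] := kp_lift_hom kp; rewrite -(scale0r 0) fZ scale0r.
split=> [v|]; last split.
- apply: kp_sep => A S T kp; have [lS lT] := kp_lift_gen kp.
  by rewrite lS lT; have [-> _] := kp.
- move=> v w; apply: kp_sep => A S T kp; have [lS lT] := kp_lift_gen kp.
  have [fD fZ fM] := kp_lift_hom kp; have [_ [h _ _ _]] := kp.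
  by rewrite fM !lS h; case: ifP => _; rewrite ?lS ?f0.
- by move=> m n mn; split; apply: kp_sep => A S T kp;
    have [lS lT] := kp_lift_gen kp; have [fD fZ fM] := kp_lift_hom kp;
    have [_ [_ /(_ m n mn) [h1 h2] _ _]] := kp; rewrite fM ?lS ?lT.
- move=> m n; apply: kp_sep => A S T kp; have [lS lT] := kp_lift_gen kp.
  have [fD fZ fM] := kp_lift_hom kp; have [_ [_ _ h _]] := kp.
  rewrite fM lS lT h (big_morph (kp_lift S T) (id1 := 0) (op1 := +%R)) ?f0 //.
  by apply: eq_bigr => ab _; rewrite fM lS lT.
- move=> v E vE; apply: kp_sep => A S T kp; have [lS lT] := kp_lift_gen kp.
  have [fD fZ fM] := kp_lift_hom kp; have [_ [_ _ _ h]] := kp.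
  rewrite kp_lift_nprod // f0 // -(h v E vE) -map_comp; congr nprod.
  by apply: eq_map => m /=; rewrite -scaleN1r fD fZ fM !lS lT scaleN1r.
Qed.

End KumjianPask.

(* Main.v *)
(** Boundary paths are handled through their filters of initial segments,
    called tight filters below.  The proof rests on one compression statement:
    for every nonzero [x] in the Kumjian-Pask algebra there are [y], [z] and a
    vertex [v] with [y x z = s_v].  Writing [x] as a combination of the
    [s_a s_b^*], choose a path [l] with [x s_l <> 0] such that every [b] that
    occurs is either a prefix of [l], or has only common extensions with [l]
    beyond which [x] vanishes.  Not extending [l] in these bad directions turns
    [x s_l] into a nonzero combination of paths [sum_j c_j s_(g_j)] with a common
    source, and aperiodicity gives [t] such that [g_0 t] has no common extension
    with the other [g_j t]; multiplying by [s_(g_0 t)^*] and [s_t] isolates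
    [c_0 s_(s(t))].

    Simplicity: a nonzero ideal then contains some [s_v], the vertices of an ideal
    are hereditary and saturated, and a boundary path that avoids them would
    contradict cofinality.  Pure infiniteness: the vertex [v] can be moved to the
    source [w] of a generalized cycle [(m, n)] with an entrance, for which
    [s_n^* s_m] is a proper isometry of [s_w]; with [y x z = s_w] the idempotent
    [x z y] is equivalent to [s_w] and lies in [x A].  That [s_v <> 0] is seen in
    the representation on functions of tight filters. *)
Require Import Defs.
From HB Require Import structures.
From mathcomp Require Import all_boot all_algebra finmap.
From mathcomp Require Import boolp classical_sets functions cardinality.
From mathcomp Require Import zify.

Set Implicit Arguments.
Unset Strict Implicit.
Unset Printing Implicit Defensive.

Import GRing.Theory.

Local Open Scope classical_set_scope.
Local Open Scope ring_scope.

(** * Degrees, paths and common extensions *)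

Section Degrees.
Context {k : nat}.
Implicit Types m n p : Nk k.

Lemma NkD m n i : (m + n) i = (m i + n i)%N.
Proof. by rewrite ffunE. Qed.

Lemma Nk0 i : (0 : Nk k) i = 0%N.
Proof. by rewrite ffunE. Qed.

Lemma Nk_leP m n : reflect (forall i, (m i <= n i)%N) (Nk_le m n).
Proof. exact: forallP. Qed.

Lemma Nk_addI m n p : m + n = m + p -> n = p.
Proof.
by move=> e; apply/ffunP=> i; apply: (@addnI (m i)); rewrite -!NkD e.
Qed.

Lemma Nk_addIr m n p : n + m = p + m -> n = p.
Proof. by rewrite !(addrC _ m); apply: Nk_addI. Qed.

Lemma Nk_subK m n : Nk_le n m -> n + Nk_sub m n = m.
Proof. by move=> /Nk_leP le; apply/ffunP=> i; rewrite NkD ffunE subnKC. Qed.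

Lemma Nk_le_refl m : Nk_le m m.
Proof. by apply/Nk_leP. Qed.

Lemma Nk_le_trans m n p : Nk_le m n -> Nk_le n p -> Nk_le m p.
Proof. by move=> /Nk_leP h /Nk_leP h'; apply/Nk_leP=> i; apply: leq_trans (h' i). Qed.

Lemma Nk_leDl m n : Nk_le m (m + n).
Proof. by apply/Nk_leP=> i; rewrite NkD leq_addr. Qed.

Lemma Nk_joinP m n p : reflect (Nk_le m p /\ Nk_le n p) (Nk_le (Nk_join m n) p).
Proof.
apply: (iffP (Nk_leP _ _)) => [h|[/Nk_leP h /Nk_leP h'] i].
  by split; apply/Nk_leP=> i; have := h i; rewrite ffunE geq_max => /andP[].
by rewrite ffunE geq_max h h'.
Qed.

Lemma xNk_geP (d : xNk k) p :
  reflect (forall i a, d i = Some a -> (p i <= a)%N) (xNk_ge d p).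
Proof.
apply: (iffP forallP) => h i; first by move=> a e; have := h i; rewrite e.
by case e: (d i) => [a|] //; apply: h.
Qed.

Lemma xNk_ge_le (d : xNk k) m n : Nk_le m n -> xNk_ge d n -> xNk_ge d m.
Proof.
move=> /Nk_leP le /xNk_geP h; apply/xNk_geP=> i a /h; exact: leq_trans.
Qed.

End Degrees.

Arguments Nk_leP {k m n}.
Arguments Nk_joinP {k m n p}.
Arguments xNk_geP {k d p}.

Section Paths.
Context {k : nat} {L : kgraph k}.
Implicit Types (v w : kobj L) (a b c l m n : L).

Lemma kcomp_inj a b c d : ksrc a = krng b -> ksrc c = krng d ->
  kcomp a b = kcomp c d -> kdeg a = kdeg c -> a = c /\ b = d.
Proof.
move=> ab cd e da.
have db : kdeg b = kdeg d.
  by apply: (@Nk_addI _ (kdeg a)); rewrite -kdeg_comp // e kdeg_comp // da.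
have [p [_ u]] := kfactor (kdeg_comp ab).
have e1 : p = (a, b) by apply: u.
have : p = (c, d) by apply: u; split.
by rewrite e1 => -[].
Qed.

Lemma kcompI a b c : ksrc a = krng b -> ksrc a = krng c ->
  kcomp a b = kcomp a c -> b = c.
Proof. by move=> ab ac e; have [] := kcomp_inj ab ac e erefl. Qed.

Lemma kcompIr a b c : ksrc a = krng c -> ksrc b = krng c ->
  kcomp a c = kcomp b c -> a = b.
Proof.
move=> ac bc e; have [] // := kcomp_inj ac bc e.
by apply: (@Nk_addIr _ (kdeg c)); rewrite -!kdeg_comp // e.
Qed.

Lemma kcut l (n : Nk k) : Nk_le n (kdeg l) ->
  exists a b, [/\ ksrc a = krng b, kcomp a b = l & kdeg a = n].
Proof.
move=> /Nk_subK e; have [[a b] [[/= ? ? ? ?] _]] := kfactor (esym e).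
by exists a, b.
Qed.

Definition pre a b : Prop := exists2 c, ksrc a = krng c & kcomp a c = b.

Lemma pre_refl a : pre a a.
Proof. by exists (kid (ksrc a)); rewrite ?krng_id ?kcompl1. Qed.

Lemma pre_trans b a c : pre a b -> pre b c -> pre a c.
Proof.
move=> [x ax <-] [y]; rewrite ksrc_comp // => xy <-.
by exists (kcomp x y); rewrite ?krng_comp ?kcompA.
Qed.

Lemma pre_comp a b : ksrc a = krng b -> pre a (kcomp a b).
Proof. by exists b. Qed.

Lemma pre_kid a : pre (kid (krng a)) a.
Proof. by exists a; rewrite ?ksrc_id ?kcomp1l. Qed.

Lemma pre_rng a b : pre a b -> krng a = krng b.
Proof. by move=> [c ac <-]; rewrite krng_comp. Qed.

Lemma pre_deg a b : pre a b -> Nk_le (kdeg a) (kdeg b).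
Proof. by move=> [c ac <-]; rewrite kdeg_comp ?Nk_leDl. Qed.

Lemma pre_compl a b c : ksrc a = krng b -> pre b c -> pre (kcomp a b) (kcomp a c).
Proof.
move=> ab [d bd <-]; exists d; first by rewrite ksrc_comp.
by rewrite kcompA.
Qed.

Lemma pre_cancel a b c : ksrc a = krng b -> ksrc a = krng c ->
  pre (kcomp a b) (kcomp a c) -> pre b c.
Proof.
move=> ab ac [d]; rewrite ksrc_comp // => bd e; exists d => //.
by apply: (kcompI (a := a)); rewrite ?krng_comp // kcompA.
Qed.

Lemma pre_degE a b c : pre a c -> pre b c -> kdeg a = kdeg b -> a = b.
Proof. by move=> [x ax <-] [y yb e] d; have [] := kcomp_inj yb ax e (esym d). Qed.

Lemma pre_total a b c : pre a c -> pre b c -> Nk_le (kdeg a) (kdeg b) -> pre a b.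
Proof.
move=> ac bc /kcut[a' [b' [ab' e da]]].
have a'b : pre a' b by exists b'.
by rewrite (pre_degE ac (pre_trans a'b bc)).
Qed.

Lemma pre_cut c (n : Nk k) : Nk_le n (kdeg c) -> exists2 a, pre a c & kdeg a = n.
Proof. by move=> /kcut[a [b [? ? ?]]]; exists a => //; exists b. Qed.

(** No degree is imposed on the common extension, so the relation passes to initial segments
    directly; it amounts to [Lmin a b] or [MCE a b] being nonempty. *)
Definition compatible a b : Prop := exists2 c, pre a c & pre b c.

Lemma compatible_sym a b : compatible a b -> compatible b a.
Proof. by move=> [c]; exists c. Qed.

(** The initial segment of degree [Nk_join (kdeg a) (kdeg b)] of the common extension already
    extends [a] and [b]; what remains is [z]. *)
Lemma compatible_Lmin a b x y : ksrc a = krng x -> ksrc b = krng y ->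
  kcomp a x = kcomp b y ->
  exists p, Lmin a b p /\ exists2 z, ksrc p.1 = krng z &
    x = kcomp p.1 z /\ y = kcomp p.2 z.
Proof.
move=> ax by_ e.
have [l lax dl] : exists2 l, pre l (kcomp a x) & kdeg l = Nk_join (kdeg a) (kdeg b).
  by apply: pre_cut; apply/Nk_joinP; split; [|rewrite e]; apply/pre_deg/pre_comp.
have [|p ap ep] := @pre_total a l (kcomp a x) (pre_comp ax) lax.
  by rewrite dl; have /Nk_joinP[] := Nk_le_refl (Nk_join (kdeg a) (kdeg b)).
have [||q bq eq] := @pre_total b l (kcomp a x) _ lax.
  by rewrite e; apply: pre_comp.
  by rewrite dl; have /Nk_joinP[] := Nk_le_refl (Nk_join (kdeg a) (kdeg b)).
have [z lz ez] := lax.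
exists (p, q); split; first by split; rewrite //= ep.
have pz : ksrc p = krng z by rewrite -lz -ep ksrc_comp.
have qz : ksrc q = krng z by rewrite -lz -eq ksrc_comp.
exists z => //=; split.
  by apply: (kcompI (a := a)); rewrite ?krng_comp // kcompA // ep ez.
by apply: (kcompI (a := b)); rewrite ?krng_comp // kcompA // eq ez e.
Qed.

Lemma Lmin_src a b p : Lmin a b p -> ksrc p.1 = ksrc p.2.
Proof. by move=> [ap bp e _]; rewrite -(ksrc_comp ap) e ksrc_comp. Qed.

Lemma compatibleP a b : compatible a b <-> Lmin a b !=set0.
Proof.
split=> [[c [x ax <-] [y by_ e]]|[[p q] [/= ap bq e _]]].
  by have [p [? _]] := compatible_Lmin ax by_ (esym e); exists p.
by exists (kcomp a p); [exists p|exists q].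
Qed.

Lemma compatible_MCE a b : compatible a b <-> MCE a b !=set0.
Proof.
split=> [/compatibleP[[p q] [/= ap bq e d]]|[c [_ [x [y [ax by_ e e']]]]]].
  by exists (kcomp a p); split=> //; exists p, q; split.
by exists c; [exists x|exists y].
Qed.

Lemma compatible_pre a b a' : pre a a' -> compatible a' b -> compatible a b.
Proof. by move=> aa' [c a'c bc]; exists c => //; apply: pre_trans a'c. Qed.

Lemma compatible_degE a b : compatible a b -> kdeg a = kdeg b -> a = b.
Proof. by move=> [c]; apply: pre_degE. Qed.

Lemma exhaustiveP v (E : set L) : exhaustive v E <->
  forall l, krng l = v -> exists2 m, E m & compatible l m.
Proof. by split=> h l /h[m Em lm]; exists m => //; apply/compatibleP. Qed.

Hypothesis L_fa : finitely_aligned L.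

(** The set usually written Ext(b; E); it carries an exhaustive set at [r(b)] over to [s(b)]. *)
Definition Ext b (E : set L) : set L :=
  [set a | exists2 m, E m & exists y, Lmin b m (a, y)].

Lemma Ext_finite b E : finite_set E -> finite_set (Ext b E).
Proof.
move=> fE.
have -> : Ext b E = \bigcup_(m in E) [set p.1 | p in Lmin b m].
  apply/seteqP; split=> a.
    by move=> [m Em [y h]]; exists m => //; exists (a, y).
  by move=> [m Em [[a' y] h <-]]; exists m => //; exists y.
by apply: bigcup_finite => // m Em; apply: finite_image.
Qed.

Lemma Ext_rng b E a : Ext b E a -> ksrc b = krng a.
Proof. by move=> [m Em [y [/=]]]. Qed.

(** The path [b t] has a common extension with some [m] in [E]; it passes through a minimal one of
    [b] and [m], whose tail is then compatible with [t]. *)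
Lemma Ext_exhaustive b E : exhaustive (krng b) E -> exhaustive (ksrc b) (Ext b E).
Proof.
move=> /exhaustiveP h; apply/exhaustiveP=> t bt.
have [|m Em] := h (kcomp b t); first by rewrite krng_comp.
move=> [c [x btx <-] [y my e]]; move: btx; rewrite ksrc_comp // => tx.
rewrite -kcompA // in e.
have [||[p q] [pq [z pz /= [ep eq]]]] := compatible_Lmin (a := b) (x := kcomp t x) _ my.
- by rewrite krng_comp.
- by [].
exists p; first by exists m => //; exists q.
by exists (kcomp p z); [rewrite -ep; exists x|exists z].
Qed.

Lemma Ext_pre b E a : Ext b E a -> exists2 m, E m & pre m (kcomp b a).
Proof. by move=> [m Em [y [/= ? ? e _]]]; exists m => //; exists y. Qed.

Lemma FE_fset_set v (E : set L) : finite_set E -> exhaustive v E ->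
  (forall m, E m -> krng m = v) -> ~ E (kid v) -> FE v (fset_set E).
Proof.
move=> fE eE rE nE; split; last by rewrite fset_setK.
by move=> m; rewrite in_fset_set // inE => Em; split; [exact: rE|move=> e; rewrite e in Em].
Qed.

Lemma FE_exhaustive v (E : {fset L}) : FE v E -> exhaustive v [set` E].
Proof. by case. Qed.

End Paths.

(** * Boundary paths *)

(** By pigeonhole, [n.+1] distinct values do not fit below [n]. *)
Lemma unbounded_inj (f : nat -> nat) : injective f -> forall n : nat, exists j, (n <= f j)%N.
Proof.
move=> fI n; apply: contrapT => h.
have := @uniq_leq_size _ (map f (iota 0 n.+1)) (iota 0 n).
rewrite map_inj_uniq // iota_uniq size_map !size_iota ltnn => /(_ isT) ci.
suff : false by []; apply: ci => _ /mapP[j _ ->]; rewrite mem_iota /= add0n.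
by rewrite ltnNge; apply/negP => nj; apply: h; exists j.
Qed.

Section Tight.
Context {k : nat} {L : kgraph k}.
Hypothesis L_fa : finitely_aligned L.
Implicit Types (v w : kobj L) (a b c l m n : L) (F : set L).

(** [FE] leaves out the sets containing the vertex itself, which [Ext b E] may do; [Q (kid v)]
    settles that case. *)
Lemma FE_ind v (Q : L -> Prop) :
  (forall E, FE v E -> exists2 m, m \in E & Q m) -> Q (kid v) ->
  forall E : set L, finite_set E -> exhaustive v E ->
    (forall m, E m -> krng m = v) -> exists2 m, E m & Q m.
Proof.
move=> h Q1 E fE eE rE; have [E1|nE1] := pselect (E (kid v)).
  by exists (kid v).
have [m] := h _ (FE_fset_set fE eE rE nE1).
by rewrite in_fset_set // inE; exists m.
Qed.

(** A tight set is the set of initial segments of a boundary path. *)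
Definition tight F : Prop :=
  [/\ F !=set0, forall a b, pre a b -> F b -> F a,
      forall a b, F a -> F b -> exists c, [/\ F c, pre a c & pre b c]
    & forall a E, F a -> FE (ksrc a) E -> exists2 m, m \in E & F (kcomp a m)].

(** On initial segments, [fshift a] is [x |-> sigma^(d a) x] and [fcons a] is
    [x |-> a x]. *)
Definition fshift a F : set L := [set m | ksrc a = krng m /\ F (kcomp a m)].

Definition fcons a F : set L :=
  [set m | exists n, [/\ F n, ksrc a = krng n & pre m (kcomp a n)]].

Lemma tight_pre F a b : tight F -> pre a b -> F b -> F a.
Proof. by move=> [_ h _ _]; apply: h. Qed.

Lemma tight_dir F a b : tight F -> F a -> F b -> exists c, [/\ F c, pre a c & pre b c].
Proof. by move=> [_ _ h _]; apply: h. Qed.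

Lemma tight_FE F a E : tight F -> F a -> FE (ksrc a) E ->
  exists2 m, m \in E & F (kcomp a m).
Proof. by move=> [_ _ _ h]; apply: h. Qed.

Lemma tight_degE F a b : tight F -> F a -> F b -> kdeg a = kdeg b -> a = b.
Proof. by move=> tF Fa Fb; have [c [_ ac bc]] := tight_dir tF Fa Fb; apply: pre_degE bc. Qed.

Lemma tight_rng F a b : tight F -> F a -> F b -> krng a = krng b.
Proof.
by move=> tF Fa Fb; have [c [_ /pre_rng-> /pre_rng->]] := tight_dir tF Fa Fb.
Qed.

Lemma tight_kid F a : tight F -> F a -> F (kid (krng a)).
Proof. by move=> tF; apply: tight_pre (pre_kid a). Qed.

Lemma tight_above F a b : tight F -> F a -> F b ->
  exists c, [/\ ksrc a = krng c, F (kcomp a c) & pre b (kcomp a c)].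
Proof.
move=> tF Fa Fb; have [d [Fd [c ac e] bd]] := tight_dir tF Fa Fb.
by exists c; rewrite e.
Qed.

Lemma fshift_tight F a : tight F -> F a -> tight (fshift a F).
Proof.
move=> tF Fa; split.
- by exists (kid (ksrc a)); split; rewrite ?krng_id // kcompl1.
- move=> b c bc [ac Fac]; have ab : ksrc a = krng b by rewrite (pre_rng bc).
  by split=> //; apply: tight_pre Fac => //; apply: pre_compl.
- move=> b c [ab Fab] [ac Fac].
  have [d [Fd abd acd]] := tight_dir tF Fab Fac.
  have [e ae ed] := pre_trans (pre_comp ab) abd; rewrite -ed in Fd abd acd.
  by exists e; split=> //; [exact: pre_cancel abd|exact: pre_cancel acd].
- move=> b E [ab Fab] bE.
  have [|m Em Fm] := tight_FE tF Fab (E := E); first by rewrite ksrc_comp.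
  have [h _] := bE; have [bm _] := h _ Em.
  by exists m => //; split; rewrite ?krng_comp // kcompA.
Qed.

Lemma fcons_tight F a : tight F -> F (kid (ksrc a)) -> tight (fcons a F).
Proof.
move=> tF F1; split.
- exists a, (kid (ksrc a)); split=> //; first by rewrite krng_id.
  by rewrite kcompl1; apply: pre_refl.
- by move=> b c bc [n [Fn an cn]]; exists n; split=> //; apply: pre_trans cn.
- move=> b c [m [Fm am bm]] [n [Fn an cn]].
  have [d [Fd md nd]] := tight_dir tF Fm Fn.
  have ad : ksrc a = krng d by rewrite -(pre_rng md).
  exists (kcomp a d); split; first by exists d; split=> //; apply: pre_refl.
    by apply: pre_trans bm _; apply: pre_compl.
  by apply: pre_trans cn _; apply: pre_compl.
move=> b E [n [Fn an [c bc e]]] bE.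
have sc : ksrc c = ksrc n by rewrite -(ksrc_comp bc) e ksrc_comp.
(* As [b c = a n], the condition [E] at [b] becomes [Ext c E] at the end of [n], where tightness of
   [F] applies. *)
have [|||||x Ex Fnx] := @FE_ind (ksrc c) (fun x => ksrc c = krng x -> F (kcomp n x)) _ _
   (Ext c [set` E]).
- move=> G; rewrite sc => nG; have [x Gx Fnx] := tight_FE tF Fn nG.
  by exists x.
- by rewrite sc kcompl1.
- by apply: Ext_finite => //; apply: finite_fset.
- by apply: Ext_exhaustive; rewrite -bc; apply: FE_exhaustive.
- by move=> m /Ext_rng.
have cx := Ext_rng Ex; have [m Em mcx] := Ext_pre Ex.
have nx : ksrc n = krng x by rewrite -sc.
exists m => //; exists (kcomp n x); split; [exact: Fnx|by rewrite krng_comp|].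
rewrite kcompA // -e -kcompA //; apply: pre_compl => //.
by rewrite bc -(krng_comp cx) (pre_rng mcx).
Qed.

Lemma fconsP F a b : tight F -> ksrc a = krng b -> fcons a F (kcomp a b) <-> F b.
Proof.
move=> tF ab; split=> [[n [Fn an abn]]|Fb].
  by apply: tight_pre Fn => //; apply: pre_cancel abn.
by exists b; split=> //; apply: pre_refl.
Qed.

Lemma fshiftK F a : tight F -> F a -> fcons a (fshift a F) = F.
Proof.
move=> tF Fa; apply/seteqP; split=> b.
  by move=> [n [[_ Fan] an ban]]; apply: tight_pre Fan.
by move=> Fb; have [c [ac Fac bac]] := tight_above tF Fa Fb; exists c; split.
Qed.

Lemma fconsK F a : tight F -> F (kid (ksrc a)) -> fshift a (fcons a F) = F.
Proof.
move=> tF F1; apply/seteqP; split=> b; first by move=> [ab /fconsP]; exact.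
move=> Fb; have ab : ksrc a = krng b by rewrite -(tight_rng tF F1 Fb) krng_id.
by split=> //; apply/fconsP.
Qed.

Lemma fshift_comp F a b : ksrc a = krng b -> fshift b (fshift a F) = fshift (kcomp a b) F.
Proof.
move=> ab; apply/seteqP; split=> c.
  by move=> [bc [_ h]]; split; rewrite ?ksrc_comp -?kcompA.
move=> []; rewrite ksrc_comp // => bc h.
by split=> //; split; rewrite ?krng_comp // kcompA.
Qed.

Lemma fcons_comp F a b : ksrc a = krng b -> fcons a (fcons b F) = fcons (kcomp a b) F.
Proof.
move=> ab; apply/seteqP; split=> c.
  move=> [m [[n [Fn bn mbn]] am cam]]; exists n; split; rewrite ?ksrc_comp //.
  by rewrite -kcompA //; apply: pre_trans cam _; apply: pre_compl.
move=> [n [Fn]]; rewrite ksrc_comp // => bn cabn.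
exists (kcomp b n); split; rewrite ?krng_comp ?kcompA //.
by exists n; split=> //; apply: pre_refl.
Qed.

Lemma fcons_kid F v : tight F -> F (kid v) -> fcons (kid v) F = F.
Proof.
move=> tF Fv; rewrite -[RHS](fshiftK tF Fv); congr fcons.
apply/seteqP; split=> a.
  move=> Fa; have := tight_rng tF Fv Fa; rewrite krng_id => va.
  by split; rewrite ?ksrc_id // va kcomp1l.
by rewrite /fshift /= ksrc_id => -[->]; rewrite kcomp1l.
Qed.

Lemma fshift_kid F v : tight F -> F (kid v) -> fshift (kid v) F = F.
Proof. by move=> tF Fv; rewrite -{1}(fcons_kid tF Fv) fconsK // ksrc_id. Qed.

(** The pair [(a, E)] is coded together with an arbitrary natural number, so
    that it is treated at infinitely many stages, hence at one where [a] is
    already an initial segment of the path under construction. *)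
Lemma tight_exists (P : L -> Prop) w : P (kid w) ->
  (forall l E, P l -> FE (ksrc l) E -> exists2 m, m \in E & P (kcomp l m)) ->
  exists F, [/\ tight F, F (kid w) & forall a, F a -> exists2 c, pre a c & F c /\ P c].
Proof.
move=> P1 PE.
have step (le : L * option (nat * L * {fset L})) : exists l', P le.1 ->
    [/\ pre le.1 l', P l' & if le.2 is Some (_, a, E) then
        pre a le.1 -> FE (ksrc a) E -> exists2 m, m \in E & pre (kcomp a m) l'
      else True].
  case: le => l [[[j a] E]|] /=; last by exists l => Pl; split=> //; apply: pre_refl.
  have [[Pl [b ab e] aE]|no] := pselect [/\ P l, pre a l & FE (ksrc a) E]; last first.
    exists l => Pl; split=> // [|al aE]; first exact: pre_refl.
    by case: no.
  have sb : ksrc b = ksrc l by rewrite -e ksrc_comp.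
  (* Since [l = a b], the requirement [E] at [a] becomes [Ext b E] at the end of [l]. *)
  have [|||||x Ex Px] := @FE_ind (ksrc b) (fun x => P (kcomp l x)) _ _ (Ext b [set` E]).
  - by move=> G; rewrite sb; apply: PE.
  - by rewrite sb kcompl1.
  - by apply: Ext_finite => //; apply: finite_fset.
  - by apply: Ext_exhaustive; rewrite -ab; apply: FE_exhaustive.
  - by move=> m /Ext_rng.
  have bx := Ext_rng Ex; have [m Em mbx] := Ext_pre Ex.
  exists (kcomp l x) => _; split=> // [|_ _].
    by apply: pre_comp; rewrite -sb.
  exists m => //; rewrite -e -kcompA //; apply: pre_compl => //.
  by rewrite ab -(krng_comp bx) (pre_rng mbx).
have [f fP] := choice step.
pose s := fix s (n : nat) := if n is n'.+1 then f (s n', choice.unpickle n') else kid w.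
have Ps (n : nat) : P (s n) by elim: n => //= n /(fP (_, choice.unpickle n))[].
have s_pre (m n : nat) : (m <= n)%N -> pre (s m) (s n).
  move=> /subnKC <-; elim: (n - m)%N => [|i IH]; first by rewrite addn0; apply: pre_refl.
  rewrite addnS; apply: pre_trans IH _.
  by have [] := fP (s (m + i)%N, choice.unpickle (m + i)%N) (Ps _).
exists [set a | exists n : nat, pre a (s n)]; split; last first.
- by move=> a [n an]; exists (s n) => //; split=> //; exists n; apply: pre_refl.
- by exists 0%N; apply: pre_refl.
split.
- by exists (kid w), 0%N; apply: pre_refl.
- by move=> a b ab [n bn]; exists n; apply: pre_trans bn.
- move=> a b [m am] [n bn]; exists (s (maxn m n)); split.
  + by exists (maxn m n); apply: pre_refl.
  + by apply: pre_trans am _; apply: s_pre; apply: leq_maxl.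
  + by apply: pre_trans bn _; apply: s_pre; apply: leq_maxr.
- move=> a E [n an] aE.
  have [|j nj] := @unbounded_inj (fun j => choice.pickle (j, a, E)) _ n.
    by move=> i j /(pcan_inj choice.pickleK) [].
  set q := choice.pickle _ in nj.
  have [_ _ /=] := fP (s q, choice.unpickle q) (Ps _); rewrite choice.pickleK.
  move=> /(_ (pre_trans an (s_pre _ _ nj)) aE)[m Em h].
  by exists m => //; exists q.+1; rewrite /= choice.pickleK.
Qed.

End Tight.

(** The bound is the predecessor of the least missing number, or infinite if none is missing. It
    supplies each coordinate of the degree of a tight set. *)
Lemma nat_downset (S : nat -> Prop) : S 0%N ->
  (forall m n, (m <= n)%N -> S n -> S m) ->
  exists o : option nat, forall n, is_true (if o is Some N then (n <= N)%N else true) <-> S n.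
Proof.
move=> S0 Sd; have [Sall|/existsNP[n0 nS]] := pselect (forall n, S n).
  by exists None.
have [|m /asboolP nm mmin] := @ex_minnP (fun n => `[< ~ S n >]).
  by exists n0; apply/asboolP.
case: m nm mmin => [//|m] nm mmin; exists (Some m) => n; split=> [nm'|Sn].
  apply: contrapT => /asboolP /mmin; lia.
by rewrite leqNgt; apply/negP => mn; apply/nm/(Sd _ n).
Qed.

(** * From tight sets to boundary paths, and aperiodicity *)

Section BoundaryPaths.
Context {k : nat} {L : kgraph k}.
Implicit Types (v w : kobj L) (a b c g d l : L) (F : set L) (p q : Nk k).

Lemma tight_degree F : tight F -> exists D : xNk k,
  forall p, xNk_ge D p <-> exists2 a, F a & kdeg a = p.
Proof.
move=> tF; have [a0 Fa0] : F !=set0 by case: tF.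
have h (i : 'I_k) : exists o : option nat,
    forall n, is_true (if o is Some N then (n <= N)%N else true) <->
      exists2 a, F a & (n <= kdeg a i)%N.
  apply: nat_downset; first by exists a0.
  by move=> m n mn [a Fa na]; exists a => //; apply: leq_trans na.
have [f fP] := choice h; exists [ffun i => f i] => p; split; last first.
  move=> [a Fa <-]; apply/forallP => i; rewrite ffunE.
  by apply/fP; exists a.
move=> /forallP pD.
have {}pD i : exists2 a, F a & (p i <= kdeg a i)%N.
  by apply/fP; have := pD i; rewrite ffunE.
(* Directedness merges the witnesses of the finitely many coordinates into one member of [F]. *)
have [a Fa pa] : exists2 a, F a & forall i, i \in enum 'I_k -> (p i <= kdeg a i)%N.
  elim: (enum _) => [|i s [a Fa IH]]; first by exists a0.
  have [b Fb pb] := pD i.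
  have [c [Fc /pre_deg/Nk_leP ac /pre_deg/Nk_leP bc]] := tight_dir tF Fa Fb.
  exists c => // j; rewrite inE => /predU1P[->|/IH h'].
    exact: leq_trans (bc i).
  exact: leq_trans (ac j).
have [|b ba <-] := @pre_cut _ _ a p.
  by apply/Nk_leP => i; apply: pa; rewrite mem_enum.
by exists b => //; apply: tight_pre ba Fa.
Qed.

(** The value at [(p, q)] is the tail leading from the member of [F] of degree [p] to that of degree
    [q]; its uniqueness gives functoriality. *)
Lemma tight_xpath F : tight F -> exists2 x : xpath L, boundary_path x &
  forall p, xNk_ge (xdeg x) p -> exists2 a, F a & xobj x p = ksrc a.
Proof.
move=> tF; have [D DP] := tight_degree tF.
have [a0 Fa0] : F !=set0 by case: tF.
have h p : exists a, xNk_ge D p -> F a /\ kdeg a = p.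
  by have [/DP[a Fa da]|nD] := pselect (xNk_ge D p); [exists a|exists a0 => /nD].
have [s sP] := choice h.
have s_pre p q : Nk_le p q -> xNk_ge D q -> pre (s p) (s q).
  move=> pq Dq; have [Fq dq] := sP _ Dq; have [Fp dp] := sP _ (xNk_ge_le pq Dq).
  have [c [_ pc qc]] := tight_dir tF Fp Fq.
  by apply: pre_total pc qc _; rewrite dp dq.
have h' (pq : Nk k * Nk k) : exists b, Nk_le pq.1 pq.2 -> xNk_ge D pq.2 ->
    ksrc (s pq.1) = krng b /\ kcomp (s pq.1) b = s pq.2.
  case: pq => p q /=; have [[pq Dq]|no] := pselect (Nk_le p q /\ xNk_ge D q).
    by have [b sb e] := s_pre _ _ pq Dq; exists b.
  by exists a0 => pq Dq; case: no.
have [t tP] := choice h'.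
pose x := XPath D (fun p => ksrc (s p)) (fun p q => t (p, q)).
have tE p q b : Nk_le p q -> xNk_ge D q -> ksrc (s p) = krng b ->
    kcomp (s p) b = s q -> t (p, q) = b.
  by move=> pq Dq sb e; have [st e'] := tP (p, q) pq Dq; apply: kcompI st sb _; rewrite e'.
exists x; last by move=> p Dp; exists (s p) => //; have [] := sP _ Dp.
split; first split=> /=.
- by move=> p Dp; apply: tE; rewrite ?Nk_le_refl ?krng_id // kcompl1.
- move=> p q pq Dq; have [/= st e] := tP (p, q) pq Dq.
  split; rewrite -?st // -?e ?ksrc_comp //.
  have [_ dq] := sP _ Dq; have [_ dp] := sP _ (xNk_ge_le pq Dq).
  by apply: (@Nk_addI _ p); rewrite Nk_subK // -{1}dp -kdeg_comp // e.
- move=> p q u pq qu Du; have Dq := xNk_ge_le qu Du.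
  have [/= st e] := tP (p, q) pq Dq; have [/= st' e'] := tP (q, u) qu Du.
  have tt : ksrc (t (p, q)) = krng (t (q, u)) by rewrite -st' -e ksrc_comp.
  apply: tE; rewrite ?krng_comp //; first exact: Nk_le_trans qu.
  by rewrite kcompA // e e'.
- move=> p Dp E pE; have [Fp dp] := sP _ Dp.
  have [m Em Fm] := tight_FE tF Fp pE; exists m.
  have sm : ksrc (s p) = krng m by have [h1 _] := pE; have [->] := h1 _ Em.
  have dm : kdeg (kcomp (s p) m) = p + kdeg m by rewrite kdeg_comp // dp.
  have Dm : xNk_ge D (p + kdeg m) by apply/DP; exists (kcomp (s p) m).
  split=> //=; apply: tE; rewrite ?Nk_leDl //.
  by have [Fm' dm'] := sP _ Dm; apply: (tight_degE tF); rewrite ?dm'.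
Qed.

Lemma cofinal_tight F v : cofinal L -> tight F -> exists2 a, F a & reaches v (ksrc a).
Proof.
move=> cL /tight_xpath[x /(cL v)[n xn vn] h].
by have [a Fa e] := h _ xn; exists a; rewrite // -e.
Qed.

Section Aperiodicity.
Variable x : xpath L.
Hypothesis x_bp : boundary_path x.

Lemma bpath_rng p q : Nk_le p q -> xNk_ge (xdeg x) q -> krng (xmor x p q) = xobj x p.
Proof. by move=> pq xq; have [[_ h _] _] := x_bp; have [] := h _ _ pq xq. Qed.

Lemma bpath_src p q : Nk_le p q -> xNk_ge (xdeg x) q -> ksrc (xmor x p q) = xobj x q.
Proof. by move=> pq xq; have [[_ h _] _] := x_bp; have [] := h _ _ pq xq. Qed.

Lemma bpath_comp p q r : Nk_le p q -> Nk_le q r -> xNk_ge (xdeg x) r ->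
  xmor x p r = kcomp (xmor x p q) (xmor x q r).
Proof. by have [[_ _ h] _] := x_bp; apply: h. Qed.

Lemma Nk_ge0 p : Nk_le 0 p.
Proof. by apply/Nk_leP => i; rewrite Nk0. Qed.

Lemma bpath_deg q : xNk_ge (xdeg x) q -> kdeg (xmor x 0 q) = q.
Proof.
move=> xq; have [[_ h _] _] := x_bp; have [_ _ ->] := h 0 q (Nk_ge0 q) xq.
by rewrite -[LHS]add0r Nk_subK // Nk_ge0.
Qed.

Lemma bpath_exhaustive p (E : set L) : xNk_ge (xdeg x) p -> finite_set E ->
  exhaustive (xobj x p) E -> (forall m, E m -> krng m = xobj x p) ->
  exists2 m, E m & xNk_ge (xdeg x) (p + kdeg m) /\ xmor x p (p + kdeg m) = m.
Proof.
move=> xp; apply: FE_ind => [G pG|].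
  by have [_ h] := x_bp; have [m [? ? ?]] := h _ xp _ pG; exists m.
by have [[h _ _] _] := x_bp; rewrite kdeg_id addr0 h.
Qed.

Hypothesis L_fa : finitely_aligned L.
Variables g d : L.
Hypotheses (gx : ksrc g = xobj x 0) (dx : ksrc d = xobj x 0).
Hypothesis gd : forall t, krng t = xobj x 0 -> compatible (kcomp g t) (kcomp d t).

(** With [t = x(0, p)], the tails [m] for which [g t m] is a minimal common extension of [g t] and
    [d t] are exhaustive at [x(p)]. The boundary path follows one of them, and [d t] is an initial
    segment of that [g t m]. *)
Lemma bpath_interleave p : xNk_ge (xdeg x) p ->
  exists2 q, xNk_ge (xdeg x) q & pre (kcomp d (xmor x 0 p)) (kcomp g (xmor x 0 q)).
Proof.
move=> xp; set t := xmor x 0 p.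
have rt : krng t = xobj x 0 by rewrite bpath_rng ?Nk_ge0.
have st : ksrc t = xobj x p by rewrite bpath_src ?Nk_ge0.
have gt : ksrc g = krng t by rewrite rt.
have dt : ksrc d = krng t by rewrite rt.
pose E := [set y.1 | y in Lmin (kcomp g t) (kcomp d t)].
have [|||m [[m' y] [/= gtm dty e _] em] [xm e']] := @bpath_exhaustive p E xp.
- exact: finite_image.
- apply/exhaustiveP => l tl; have sl : ksrc t = krng l by rewrite tl.
  have [|c [y gtl <-] [z dtl e]] := gd (t := kcomp t l); first by rewrite krng_comp.
  rewrite !ksrc_comp ?krng_comp // in gtl dtl.
  have A f u : ksrc f = krng t -> ksrc l = krng u ->
      kcomp (kcomp f (kcomp t l)) u = kcomp (kcomp f t) (kcomp l u).
    by move=> ft lu; rewrite (kcompA ft sl) -kcompA ?ksrc_comp.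
  rewrite !A // in e.
  have [||[p1 p2] [ph [u pu [eu _]]]] := compatible_Lmin _ _ (esym e);
    rewrite ?ksrc_comp ?krng_comp //.
  exists p1; first by exists (p1, p2).
  by exists (kcomp l y); [exists y|exists u].
- by move=> _ [[m1 m2] [/= h _ _ _] <-]; rewrite -h ksrc_comp.
rewrite /= in em; subst m'.
exists (p + kdeg m) => //; rewrite (@bpath_comp 0 p) ?Nk_ge0 ?Nk_leDl // e'.
rewrite kcompA //; last by rewrite -gtm ksrc_comp.
by rewrite e; exists y.
Qed.

End Aperiodicity.

(** Otherwise [g x = d x] for every boundary path [x] at the common source, by
    [bpath_interleave].  Then [x] has the same shifts by [m - n] and [n - m]
    (truncated, with [m] and [n] the degrees), and infinite degree in the
    coordinates where [m] and [n] differ. *)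
Lemma aperiodic_separates g d : finitely_aligned L -> aperiodic L ->
  ksrc g = ksrc d -> g <> d ->
  exists2 t, ksrc g = krng t & ~ compatible (kcomp g t) (kcomp d t).
Proof.
move=> L_fa L_ap sgd ngd; apply: contrapT => no.
have gd t : krng t = ksrc g -> compatible (kcomp g t) (kcomp d t).
  by move=> rt; apply: contrapT => h; apply: no; exists t.
(* Distinct paths of equal degree have no common extension. *)
have mn : kdeg g <> kdeg d.
  move=> e; apply: ngd; apply: compatible_degE e.
  have := gd (kid (ksrc g)) (krng_id _).
  by rewrite {2}sgd !kcompl1.
set m := kdeg g in mn; set n := kdeg d in mn.
pose m' := Nk_sub m n; pose n' := Nk_sub n m.
have mnE : n + m' = m + n' by apply/ffunP => i; rewrite !NkD !ffunE; lia.
have [|x [xb x0 xmn]] := L_ap (ksrc g) m' n'.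
  by move=> e; apply: mn; apply: (@Nk_addIr _ m'); rewrite {1}e mnE.
have [gx dx] : ksrc g = xobj x 0 /\ ksrc d = xobj x 0 by rewrite -sgd.
have gdx t : krng t = xobj x 0 -> compatible (kcomp g t) (kcomp d t) by rewrite x0; apply: gd.
have dgx t : krng t = xobj x 0 -> compatible (kcomp d t) (kcomp g t).
  by move=> /gdx /compatible_sym.
have dpre := bpath_interleave xb L_fa gx dx gdx.
have gpre := bpath_interleave xb L_fa dx gx dgx.
have cg p : xNk_ge (xdeg x) p -> ksrc g = krng (xmor x 0 p).
  by move=> xp; rewrite bpath_rng ?Nk_ge0.
have cd p : xNk_ge (xdeg x) p -> ksrc d = krng (xmor x 0 p).
  by move=> xp; rewrite bpath_rng ?Nk_ge0.
(* The degree [p] uses up all of the finite degree [a] in direction [i], so the two interleavings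
   give both inequalities between [m i] and [n i]. *)
have fin i (a : nat) : xdeg x i = Some a -> m i = n i.
  move=> xi; pose p : Nk k := [ffun j => if j == i then a else 0%N].
  have xp : xNk_ge (xdeg x) p.
    apply/xNk_geP => j b; rewrite ffunE; case: eqP => [-> | //].
    by rewrite xi => -[->].
  have [q xq /pre_deg/Nk_leP/(_ i)] := dpre _ xp.
  have [r xr /pre_deg/Nk_leP/(_ i)] := gpre _ xp.
  rewrite !kdeg_comp ?bpath_deg -?cg -?cd // !NkD ffunE eqxx.
  have := xNk_geP xq _ _ xi; have := xNk_geP xr _ _ xi.
  rewrite -/m -/n; lia.
have xm' : xNk_ge (xdeg x) m'.
  by apply/xNk_geP => i a /fin e; rewrite ffunE e subnn.
have xn' : xNk_ge (xdeg x) n'.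
  by apply/xNk_geP => i a /fin e; rewrite ffunE e subnn.
case: xmn => [/negP|]; apply.
  apply/xNk_geP => i a e; rewrite ffunE geq_max.
  by rewrite (xNk_geP xm' _ _ e) (xNk_geP xn' _ _ e).
have shE (r p : Nk k) :
    xNk_ge (xdeg x) r -> xNk_ge (xNk_sub (xdeg x) r) p -> xNk_ge (xdeg x) (r + p).
  move=> /xNk_geP xr /xNk_geP h; apply/xNk_geP => i a e.
  have := h i (a - r i)%N; rewrite ffunE e => /(_ erefl).
  by have := xr _ _ e; rewrite NkD; lia.
have degE : xNk_sub (xdeg x) m' = xNk_sub (xdeg x) n'.
  apply/ffunP => i; rewrite !ffunE; case e: (xdeg x i) => [a|] //=.
  by rewrite (fin _ _ e) !subnn.
(* Both sides are initial segments of one path [g x(0, j)], with [j] a join, and have equal degree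
   because [n + m' = m + n']. *)
have preE p : xNk_ge (xNk_sub (xdeg x) m') p ->
    kcomp d (xmor x 0 (m' + p)) = kcomp g (xmor x 0 (n' + p)).
  move=> xp; have xmp := shE _ _ xm' xp; have xnp : xNk_ge (xdeg x) (n' + p).
    by apply: shE; rewrite -?degE.
  have [q xq dq] := dpre _ xmp.
  have xj : xNk_ge (xdeg x) (Nk_join q (n' + p)).
    apply/xNk_geP => i a e; rewrite ffunE geq_max.
    by rewrite (xNk_geP xq _ _ e) (xNk_geP xnp _ _ e).
  have /Nk_joinP[qj nj] := Nk_le_refl (Nk_join q (n' + p)).
  have gj r : Nk_le r (Nk_join q (n' + p)) ->
      pre (kcomp g (xmor x 0 r)) (kcomp g (xmor x 0 (Nk_join q (n' + p)))).
    move=> rj; have xr := xNk_ge_le rj xj; apply: pre_compl; first exact: cg.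
    rewrite [X in pre _ X](bpath_comp xb (Nk_ge0 r) rj) //.
    by apply: pre_comp; rewrite bpath_src ?Nk_ge0 // bpath_rng.
  apply: pre_degE (pre_trans dq (gj _ qj)) (gj _ nj) _.
  by rewrite !kdeg_comp ?bpath_deg -?cg -?cd // -/m -/n !addrA mnE.
have morE p q : Nk_le p q -> xNk_ge (xNk_sub (xdeg x) m') q ->
    xmor x (m' + p) (m' + q) = xmor x (n' + p) (n' + q).
  move=> pq xq; have xp := xNk_ge_le pq xq.
  have xmq := shE _ _ xm' xq; have xnq : xNk_ge (xdeg x) (n' + q).
    by apply: shE; rewrite -?degE.
  have mpq : Nk_le (m' + p) (m' + q).
    by apply/Nk_leP => i; rewrite !NkD leq_add2l; apply: (Nk_leP pq).
  have npq : Nk_le (n' + p) (n' + q).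
    by apply/Nk_leP => i; rewrite !NkD leq_add2l; apply: (Nk_leP pq).
  have xmp := xNk_ge_le mpq xmq; have xnp := xNk_ge_le npq xnq.
  have := preE _ xq; rewrite (bpath_comp xb (Nk_ge0 _) mpq) // (bpath_comp xb (Nk_ge0 _) npq) //.
  have sm : ksrc (xmor x 0 (m' + p)) = krng (xmor x (m' + p) (m' + q)).
    by rewrite bpath_src ?Nk_ge0 // bpath_rng.
  have sn : ksrc (xmor x 0 (n' + p)) = krng (xmor x (n' + p) (n' + q)).
    by rewrite bpath_src ?Nk_ge0 // bpath_rng.
  rewrite !kcompA -?cg -?cd // -preE // => e.
  have dm : ksrc (kcomp d (xmor x 0 (m' + p))) = krng (xmor x (m' + p) (m' + q)).
    by rewrite ksrc_comp -?cd.
  have dn : ksrc (kcomp d (xmor x 0 (m' + p))) = krng (xmor x (n' + p) (n' + q)).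
    by rewrite preE // ksrc_comp -?cg.
  by have [] := kcomp_inj dm dn e erefl.
split=> //=.
move=> p xp; have xmp := shE _ _ xm' xp; have xnp : xNk_ge (xdeg x) (n' + p).
  by apply: shE; rewrite -?degE.
by rewrite -(bpath_rng xb (Nk_le_refl _) xmp) morE ?Nk_le_refl // bpath_rng ?Nk_le_refl.
Qed.

End BoundaryPaths.

(** * The boundary path representation *)

Section Endomorphisms.
Context (R : comPzRingType) (V : lmodType R).

Definition is_linear : {pred V -> V} := fun f => `[< linear f >].

Fact is_linear_submod : submod_closed is_linear.
Proof.
split=> [|c f g /asboolP lf /asboolP lg]; apply/asboolP => a u v /=.
  by rewrite scaler0 addr0.
rewrite !fctE lf lg !scalerDr !scalerA (mulrC c) -!addrA; congr (_ + _).
by rewrite addrCA.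
Qed.

HB.instance Definition _ := GRing.isSubmodClosed.Build R (V -> V) is_linear is_linear_submod.

Record endo := Endo { endo_fun :> V -> V; endo_linear : endo_fun \in is_linear }.

HB.instance Definition _ := [isSub for endo_fun].
HB.instance Definition _ := [Choice of endo by <:].
HB.instance Definition _ := [SubChoice_isSubLmodule of endo by <:].

Lemma endoD (f g : endo) x : (f + g) x = f x + g x. Proof. by []. Qed.
Lemma endo0 x : (0 : endo) x = 0. Proof. by []. Qed.
Lemma endoN (f : endo) x : (- f) x = - f x. Proof. by []. Qed.

Lemma endo_appD (f : endo) x y : f (x + y) = f x + f y.
Proof. by have /asboolP/(_ 1 x y) := endo_linear f; rewrite !scale1r. Qed.
Lemma endo_app0 (f : endo) : f 0 = 0.
Proof. by apply: (addrI (f 0)); rewrite -endo_appD !addr0. Qed.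
Lemma endo_appZ (f : endo) c x : f (c *: x) = c *: f x.
Proof. by have /asboolP/(_ c x 0) := endo_linear f; rewrite endo_app0 !addr0. Qed.

Fact endo_comp_linear (f g : endo) : f \o g \in is_linear.
Proof. by apply/asboolP => c x y /=; rewrite endo_appD endo_appZ endo_appD endo_appZ. Qed.

Definition endo_comp f g := Endo (endo_comp_linear f g).

Lemma endoP (f g : endo) : (forall x, f x = g x) -> f = g.
Proof. by move=> h; apply: val_inj; apply/funext. Qed.

Fact endo_compA : associative endo_comp.
Proof. by move=> f g h; apply: endoP. Qed.
Fact endo_compDl : left_distributive endo_comp +%R.
Proof. by move=> f g h; apply: endoP. Qed.
Fact endo_compDr : right_distributive endo_comp +%R.
Proof. by move=> f g h; apply: endoP => x; apply: (endo_appD f (g x) (h x)). Qed.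
Fact endo_scaleAl c f g : c *: endo_comp f g = endo_comp (c *: f) g.
Proof. exact: endoP. Qed.
Fact endo_scaleAr c f g : c *: endo_comp f g = endo_comp f (c *: g).
Proof. by apply: endoP => x; apply/esym/(endo_appZ f c (g x)). Qed.

HB.instance Definition _ := Lmodule_isNalgebra.Build R endo
  endo_compA endo_compDl endo_compDr endo_scaleAl endo_scaleAr.

Lemma endoM (f g : endo) x : (f ** g) x = f (g x). Proof. by []. Qed.

Lemma endo_sum (I : Type) (s : seq I) (f : I -> endo) x :
  (\sum_(i <- s) f i) x = \sum_(i <- s) f i x.
Proof. by elim: s => [|i s IH]; rewrite ?big_nil // !big_cons endoD IH. Qed.

End Endomorphisms.

Arguments endo_fun : simpl never.

Section BoundaryRepresentation.
Context {k : nat} {L : kgraph k} (R : comPzRingType).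
Hypothesis L_fa : finitely_aligned L.
Implicit Types (v w : kobj L) (a b c l m n : L) (F : set L).

(** Functions live on all sets of paths, and the operators below vanish off the tight ones; this
    avoids a subtype. *)
Let V : lmodType R := set L -> R^o.

(** In terms of boundary paths, [opS a] sends the point mass at [x] to the one at [a x], or to 0 if
    [x] does not start at [s(a)]; [opT a] is its partial inverse. *)
Definition opS a (f : V) : V :=
  fun F => if `[< tight F /\ F a >] then f (fshift a F) else 0.
Definition opT a (f : V) : V :=
  fun F => if `[< tight F /\ F (kid (ksrc a)) >] then f (fcons a F) else 0.

Fact opS_linear a : opS a \in @is_linear R V.
Proof.
apply/asboolP => c f g; apply/funext => F; rewrite /opS !fctE.
by case: ifP => // _; rewrite scaler0 addr0.
Qed.

Fact opT_linear a : opT a \in @is_linear R V.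
Proof.
apply/asboolP => c f g; apply/funext => F; rewrite /opT !fctE.
by case: ifP => // _; rewrite scaler0 addr0.
Qed.

Definition S_rep a : endo V := Endo (opS_linear a).
Definition T_rep a : endo V := Endo (opT_linear a).

Lemma S_repE a f F : tight F -> F a -> S_rep a f F = f (fshift a F).
Proof. by move=> tF Fa; rewrite /S_rep /endo_fun /opS asboolT. Qed.

Lemma S_rep0 a f F : ~ (tight F /\ F a) -> S_rep a f F = 0.
Proof. by move=> h; rewrite /S_rep /endo_fun /opS asboolF. Qed.

Lemma T_repE a f F : tight F -> F (kid (ksrc a)) -> T_rep a f F = f (fcons a F).
Proof. by move=> tF Fa; rewrite /T_rep /endo_fun /opT asboolT. Qed.

Lemma T_rep0 a f F : ~ (tight F /\ F (kid (ksrc a))) -> T_rep a f F = 0.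
Proof. by move=> h; rewrite /T_rep /endo_fun /opT asboolF. Qed.

Lemma fshift_src F a : tight F -> F a -> fshift a F (kid (ksrc a)).
Proof. by move=> tF Fa; split; rewrite ?krng_id ?kcompl1. Qed.

Lemma fcons_self F a : F (kid (ksrc a)) -> fcons a F a.
Proof.
move=> Fa; exists (kid (ksrc a)); rewrite krng_id kcompl1.
by split=> //; apply: pre_refl.
Qed.

Lemma ST_repE a f F : tight F -> F a -> S_rep a (T_rep a f) F = f F.
Proof.
move=> tF Fa; rewrite S_repE // T_repE ?fshiftK //; last exact: fshift_src.
exact: fshift_tight.
Qed.

(** Multiplication operators. The products [S_m S_m^*] are of this kind, which makes (KP4) a
    pointwise statement. *)
Definition is_diag (x : endo V) (phi : set L -> R) :=
  forall f F, x f F = phi F * f F.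

Lemma is_diagM x y phi psi : is_diag x phi -> is_diag y psi ->
  is_diag (x ** y) (fun F => phi F * psi F).
Proof. by move=> hx hy f F; rewrite endoM hx hy mulrA. Qed.

Lemma nprod_diag (I : eqType) (s : seq I) (x : I -> endo V) phi F i :
  (forall i, is_diag (x i) (phi i)) -> i \in s -> phi i F = 0 ->
  forall f, nprod [seq x i | i <- s] f F = 0.
Proof.
move=> xphi si phi0 f; case: s si => [|j s] //= si.
have h t y psi : is_diag y psi ->
    is_diag (foldl nmul y [seq x i | i <- t]) (fun F => psi F * \prod_(i <- t) phi i F).
  elim: t y psi => [|l t IH] y psi hy f' F' /=.
    by rewrite big_nil mulr1 hy.
  by rewrite (IH _ _ (is_diagM hy (xphi l))) big_cons !mulrA.
rewrite (h _ _ _ (xphi j)).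
have -> : phi j F * \prod_(i <- s) phi i F = \prod_(i <- j :: s) phi i F.
  by rewrite big_cons.
by rewrite (big_rem i) //= phi0 !mul0r.
Qed.

Lemma boundary_family : kp_family S_rep T_rep.
Proof.
split=> [v|]; first apply: endoP => f.
  apply/funext => F; have [[tF Fv]|nF] := pselect (tight F /\ F (kid v)).
    by rewrite S_repE // T_repE ?ksrc_id // fshift_kid ?fcons_kid.
  by rewrite S_rep0 // T_rep0 ?ksrc_id.
split.
- move=> v w; apply: endoP => f; apply/funext => F; rewrite endoM.
  have [[tF Fv]|nF] := pselect (tight F /\ F (kid v)); last first.
    by rewrite S_rep0 //; case: eqP => _; rewrite ?S_rep0 ?endo0.
  rewrite S_repE // fshift_kid //; case: eqP => [-> //|vw].
  rewrite S_rep0 ?endo0 // => -[_ Fw]; apply: vw.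
  by have := tight_rng tF Fv Fw; rewrite !krng_id.
- move=> m n mn; split; apply: endoP => f; apply/funext => F; rewrite endoM.
    have [[tF Fmn]|nF] := pselect (tight F /\ F (kcomp m n)); last first.
      rewrite [RHS]S_rep0 //.
      have [[tF Fm]|nm] := pselect (tight F /\ F m); last by rewrite S_rep0.
      by rewrite S_repE // S_rep0 // => -[_ [_ ?]]; apply: nF.
    have Fm : F m by apply: tight_pre (pre_comp mn) Fmn.
    by rewrite S_repE // S_repE // ?fshift_comp // -?S_repE //; apply: fshift_tight.
  have [[tF Fn]|nF] := pselect (tight F /\ F (kid (ksrc n))); last first.
    by rewrite !T_rep0 // ksrc_comp.
  rewrite !T_repE // ?ksrc_comp ?fcons_comp //; first exact: fcons_tight.
  by rewrite mn; apply: tight_kid (fcons_self Fn); apply: fcons_tight.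
- move=> m n; apply: endoP => f; apply/funext => F.
  rewrite endoM endo_sum fct_sumE.
  have [tF|nF] := pselect (tight F); last first.
    rewrite T_rep0 ?big1 // => [p _|[]//].
    by rewrite endoM S_rep0 // => -[].
  (* At most one summand survives at [F]: [m a] has the prescribed degree, so [a] is determined by
     [F], and then [b] by [m a = n b]. *)
  have [[[a b] [[/= ma nb e d] Fa]]|no] := pselect (exists p, Lmin m n p /\ F p.1).
    have Fm : F (kid (ksrc m)) by rewrite ma; apply: tight_kid.
    have tG := fshift_tight tF Fa.
    have sab : ksrc a = ksrc b by rewrite -(ksrc_comp ma) e ksrc_comp.
    have Gb : fshift a F (kid (ksrc b)) by rewrite -sab; apply: fshift_src.
    have tbG := fcons_tight L_fa tG Gb.
    have bGn : fcons b (fshift a F) (kid (ksrc n)).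
      by rewrite nb; apply: tight_kid (fcons_self Gb).
    have mF : fcons m F = fcons n (fcons b (fshift a F)).
      by rewrite fcons_comp // -e -fcons_comp // fshiftK.
    rewrite T_repE // mF S_repE; [|exact: fcons_tight|exact: fcons_self].
    rewrite fconsK // (bigD1_seq (a, b)) /=; last by apply: fset_uniq.
      rewrite endoM S_repE // T_repE // big1_seq ?addr0 // => -[a' b'] /= /andP[neq].
      rewrite in_fset_set // inE => -[/= ma' nb' e' d']; rewrite endoM S_rep0 // => -[_ Fa'].
      have aa' : a' = a.
        apply: (tight_degE tF) => //; apply: (@Nk_addI _ (kdeg m)).
        by rewrite -!kdeg_comp // d d'.
      move: neq e'; rewrite aa' e => neq /(kcompI nb nb') bb'.
      by rewrite bb' eqxx in neq.
    by rewrite in_fset_set // inE; split.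
  (* Both sides vanish: if [n] began the path [m F], a pair in [Lmin m n] with first entry in [F]
     would result. *)
  rewrite [RHS]big1_seq => [|[a b] /= h].
    have [Fm|nm] := pselect (F (kid (ksrc m))); last by rewrite T_rep0 // => -[].
    rewrite T_repE // S_rep0 // => -[_ [c [Fc mc [d nd e]]]]; apply: no.
    have [p [mnp [z pz [ec _]]]] := compatible_Lmin mc nd (esym e).
    exists p; split=> //; apply: tight_pre Fc => //.
    by rewrite ec; apply: pre_comp.
  rewrite endoM S_rep0 // => -[_ Fa]; apply: no; exists (a, b); split=> //.
  by move: h; rewrite in_fset_set // inE.
- move=> v E [rE eE]; apply: endoP => f; apply/funext => F.
  pose chi m F := (if `[< tight F /\ F m >] then 1 else 0) : R.
  have chiE m : is_diag (S_rep m ** T_rep m) (chi m).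
    move=> g G; rewrite endoM /chi; case: asboolP => [[tG Gm]|nG].
      by rewrite ST_repE // mul1r.
    by rewrite S_rep0 // mul0r.
  have phiE m : is_diag (S_rep (kid v) - S_rep m ** T_rep m)
      (fun F => chi (kid v) F - chi m F).
    move=> g G; rewrite endoD endoN !fctE chiE mulrBl; congr (_ - _).
    rewrite /chi; case: asboolP => [[tG Gv]|nG]; last by rewrite S_rep0 // mul0r.
    by rewrite S_repE // fshift_kid // mul1r.
  (* One factor vanishes at [F]: tightness provides [m] if [F] is tight and contains [v]; otherwise
     all indicators are 0 and any element of [E] will do. *)
  have [m Em h] : exists2 m, m \in E & chi (kid v) F = chi m F.
    have [[tF Fv]|nF] := pselect (tight F /\ F (kid v)).
      have [|m Em] := tight_FE tF Fv (E := E); first by rewrite ksrc_id.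
      have [rm _] := rE _ Em; rewrite -{1}rm kcomp1l => Fm.
      by exists m; rewrite // /chi !asboolT.
    have [m Em _] := eE _ (krng_id v); exists m => //.
    rewrite /chi !asboolF // => -[tF Fm]; apply: nF; split=> //.
    by have [<- _] := rE _ Em; apply: tight_kid.
  by apply: (nprod_diag phiE Em); rewrite h subrr.
Qed.

(** On a tight set through [v], [S_v] keeps the value 1 of the constant function. *)
Lemma S_rep_neq0 (R1 : (1 : R) != 0) v : S_rep (kid v) <> 0.
Proof.
move=> S0; have [|l E _ [_ /(_ _ (krng_id _))[m]]|F [tF Fv _]] :=
  @tight_exists _ L L_fa (fun=> True) v.
- by [].
- by move=> Em _; exists m.
have := congr1 (fun x : endo V => x (fun=> 1) F) S0.
by rewrite S_repE // => /eqP; rewrite (negPf R1).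
Qed.
End BoundaryRepresentation.

(** * Kumjian-Pask families *)

Section NalgebraTheory.
Context {R : comPzRingType} {A : nalgType R}.
Implicit Types x y z : A.

Lemma nmul0r x : 0 ** x = 0.
Proof. by apply: (addrI (0 ** x)); rewrite -nmulDl !addr0. Qed.

Lemma nmulr0 x : x ** 0 = 0.
Proof. by apply: (addrI (x ** 0)); rewrite -nmulDr !addr0. Qed.

Lemma nmulNr x y : x ** (- y) = - (x ** y).
Proof. by apply: (addrI (x ** y)); rewrite -nmulDr !subrr nmulr0. Qed.

Lemma nmulrN x y : (- x) ** y = - (x ** y).
Proof. by apply: (addrI (x ** y)); rewrite -nmulDl !subrr nmul0r. Qed.

Lemma nmulBr x y z : x ** (y - z) = x ** y - x ** z.
Proof. by rewrite nmulDr nmulNr. Qed.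

Lemma nmulBl x y z : (x - y) ** z = x ** z - y ** z.
Proof. by rewrite nmulDl nmulrN. Qed.

Lemma nmul_sumr (I : Type) (s : seq I) (P : pred I) (f : I -> A) x :
  x ** (\sum_(i <- s | P i) f i) = \sum_(i <- s | P i) x ** f i.
Proof. exact: (big_morph (nmul x) (nmulDr x) (nmulr0 x)). Qed.

Lemma nmul_suml (I : Type) (s : seq I) (P : pred I) (f : I -> A) x :
  (\sum_(i <- s | P i) f i) ** x = \sum_(i <- s | P i) f i ** x.
Proof. exact: (big_morph (nmul^~ x) (fun y z => nmulDl y z x) (nmul0r x)). Qed.

End NalgebraTheory.

Section KPFamily.
Context {k : nat} {L : kgraph k} {R : comPzRingType} {A : nalgType R} {S T : L -> A}.
Hypothesis L_fa : finitely_aligned L.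
Hypothesis kp : kp_family S T.
Implicit Types (v w : kobj L) (a b c g l m n : L) (x y z : A).

Lemma Tkid v : T (kid v) = S (kid v).
Proof. by have [] := kp. Qed.

Lemma SM a b : ksrc a = krng b -> S a ** S b = S (kcomp a b).
Proof. by have [_ [_ h _ _]] := kp => /h[]. Qed.

Lemma TM a b : ksrc a = krng b -> T b ** T a = T (kcomp a b).
Proof. by have [_ [_ h _ _]] := kp => /h[]. Qed.

Lemma TSE a b : T a ** S b = \sum_(p <- fset_set (Lmin a b)) S p.1 ** T p.2.
Proof. by have [_ [_ _ h _]] := kp. Qed.

Lemma in_Lmin a b (p : L * L) : p \in fset_set (Lmin a b) -> Lmin a b p.
Proof. by rewrite in_fset_set // inE. Qed.

Lemma S_src a : S a ** S (kid (ksrc a)) = S a.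
Proof. by rewrite SM ?krng_id // kcompl1. Qed.

Lemma S_rng a : S (kid (krng a)) ** S a = S a.
Proof. by rewrite SM ?ksrc_id // kcomp1l. Qed.

Lemma T_src a : S (kid (ksrc a)) ** T a = T a.
Proof. by rewrite -Tkid TM ?krng_id // kcompl1. Qed.

Lemma T_rng a : T a ** S (kid (krng a)) = T a.
Proof. by rewrite -Tkid TM ?ksrc_id // kcomp1l. Qed.

Lemma Sid v : S (kid v) ** S (kid v) = S (kid v).
Proof. by have := S_src (kid v); rewrite ksrc_id. Qed.

Lemma TS0 a b : ~ compatible a b -> T a ** S b = 0.
Proof.
move=> nab; rewrite TSE big1_seq // => p /andP[_ /in_Lmin abp].
by case: nab; apply/compatibleP; exists p.
Qed.

Lemma TS_self a : T a ** S a = S (kid (ksrc a)).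
Proof.
have aE : Lmin a a = [set (kid (ksrc a), kid (ksrc a))].
  apply/seteqP; split=> [[b c] [/= ab ac /(kcompI ab ac) <- d]|_ ->]; last first.
    split; rewrite /= ?krng_id // kcompl1.
    by apply/ffunP => i; rewrite ffunE maxnn.
  have -> // : b = kid (ksrc a).
  rewrite ab; apply/kdeg0E; apply: (@Nk_addI _ (kdeg a)); rewrite addr0 -kdeg_comp //.
  by rewrite d; apply/ffunP => i; rewrite ffunE maxnn.
rewrite TSE aE fset_set1 big_seq_fset1 /= Tkid; exact: Sid.
Qed.

Lemma TS_comp a b : ksrc a = krng b -> T a ** S (kcomp a b) = S b.
Proof. by move=> ab; rewrite -SM // nmulA TS_self ab S_rng. Qed.

(** Under right multiplication each factor [S_v - S_m S_m^*] fixes [x], hence so does their product,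
    which is 0 by (KP4). *)
Lemma exhaustive_annihilates v (E : {fset L}) x : FE v E ->
  x ** S (kid v) = x -> (forall m, m \in E -> x ** S m = 0) -> x = 0.
Proof.
move=> vE xv xE.
have h (s : seq L) y : (forall m, m \in s -> x ** S m = 0) -> x ** y = x ->
    x ** foldl nmul y [seq S (kid v) - S m ** T m | m <- s] = x.
  elim: s y => //= m s IH y xs xy; apply: IH.
    by move=> n ns; apply: xs; rewrite inE ns orbT.
  by rewrite nmulA xy nmulBr xv nmulA xs ?mem_head // nmul0r subr0.
have [_ [_ _ _ /(_ _ _ vE)]] := kp.
have {}xE : forall m, m \in enum_fset E -> x ** S m = 0 by exact: xE.
(* Exhaustiveness makes [E] nonempty, so that [nprod] is a true product and not its default value
   0. *)
have [_ /(_ _ (krng_id v))[m0]] := vE.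
have m0E : [set` E] m0 -> m0 \in enum_fset E by [].
move=> /m0E {m0E} + _; case: (enum_fset E) xE => //= m s xs _ e.
rewrite -(h s (S (kid v) - S m ** T m)) ?e ?nmulr0 // => [n ns|].
  by apply: xs; rewrite inE ns orbT.
by rewrite nmulBr xv nmulA xs ?mem_head // nmul0r subr0.
Qed.

(** The coefficients range over the whole algebra, so this is a left ideal; by [ghost_span_eq0] the
    [S n] detect its nonzero elements. *)
Definition ghost_span (s : seq L) x : Prop :=
  exists f : L -> A, x = \sum_(n <- s) f n ** T n.

Lemma ghost_spanD s x y : ghost_span s x -> ghost_span s y -> ghost_span s (x + y).
Proof.
move=> [f ->] [g ->]; exists (fun n => f n + g n).
by rewrite -big_split; apply: eq_bigr => n _; rewrite nmulDl.
Qed.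

Lemma ghost_span0 s : ghost_span s 0.
Proof. by exists (fun=> 0); rewrite big1 // => n _; rewrite nmul0r. Qed.

Lemma ghost_span_sum s (I : Type) (t : seq I) (P : pred I) (f : I -> A) :
  (forall i, P i -> ghost_span s (f i)) -> ghost_span s (\sum_(i <- t | P i) f i).
Proof. by move=> h; apply: big_ind => //; [exact: ghost_span0|exact: ghost_spanD]. Qed.

Lemma mem_ghost_span s n x : uniq s -> n \in s -> ghost_span s (x ** T n).
Proof.
move=> us ns; exists (fun m => if m == n then x else 0).
rewrite (bigD1_seq n) //= eqxx big1 ?addr0 // => m /negPf ->.
by rewrite nmul0r.
Qed.

(** Subtracting [x S_n S_n^* = 0] removes the term at [n], and stays in the span
    of the other [T m] because [T_m S_n S_n^*] is a left multiple of [T_m]. *)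
Lemma ghost_span_eq0 s x : ghost_span s x -> (forall n, n \in s -> x ** S n = 0) -> x = 0.
Proof.
move=> [f]; elim: s f => [|n s IH] f; first by rewrite big_nil.
rewrite big_cons => xE xs; pose q m := \sum_(p <- fset_set (Lmin m n)) S p.1 ** T p.1.
have qE m : T m ** (S n ** T n) = q m ** T m.
  rewrite nmulA TSE !nmul_suml; apply: eq_big_seq => -[a b] /in_Lmin[/= ma nb e _].
  by rewrite -!nmulA !TM // e.
apply: (IH (fun m => f m - f m ** q m)) => [|m ms]; last first.
  by apply: xs; rewrite inE ms orbT.
have -> : x = x - x ** (S n ** T n) by rewrite nmulA xs ?mem_head // nmul0r subr0.
rewrite {1}xE {1}xE nmulDl -nmulA [T n ** _]nmulA TS_self T_src nmul_suml.
rewrite opprD addrACA subrr add0r -sumrB; apply: eq_bigr => m _.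
by rewrite -nmulA qE nmulBl nmulA.
Qed.

Definition spanned x : Prop := exists s : seq (R * (L * L)),
  (forall i, i \in s -> ksrc i.2.1 = ksrc i.2.2) /\
  x = \sum_(i <- s) i.1 *: (S i.2.1 ** T i.2.2).

Lemma spannedD x y : spanned x -> spanned y -> spanned (x + y).
Proof.
move=> [s [hs ->]] [t [ht ->]]; exists (s ++ t); rewrite big_cat; split=> // i.
by rewrite mem_cat => /orP[/hs|/ht].
Qed.

Lemma spanned0 : spanned 0.
Proof. by exists [::]; rewrite big_nil. Qed.

Lemma spanned_sum (I : eqType) (t : seq I) (f : I -> A) :
  (forall i, i \in t -> spanned (f i)) -> spanned (\sum_(i <- t) f i).
Proof.
move=> h; rewrite big_seq; apply: big_ind => //; [exact: spanned0|exact: spannedD].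
Qed.

Lemma spannedZ (r : R) x : spanned x -> spanned (r *: x).
Proof.
move=> [s [hs ->]]; exists [seq (r * i.1, i.2) | i <- s]; split.
  by move=> _ /mapP[i /hs ? ->].
by rewrite big_map scaler_sumr; apply: eq_bigr => i _; rewrite scalerA.
Qed.

Lemma spannedST a b : ksrc a = ksrc b -> spanned (S a ** T b).
Proof.
move=> ab; exists [:: (1, (a, b))]; rewrite big_seq1 scale1r; split=> // i.
by rewrite inE => /eqP ->.
Qed.

Lemma spannedS a : spanned (S a).
Proof. by rewrite -(S_src a) -Tkid; apply: spannedST; rewrite ksrc_id. Qed.

Lemma spannedT a : spanned (T a).
Proof. by rewrite -(T_src a); apply: spannedST; rewrite ksrc_id. Qed.

Lemma spannedM x y : spanned x -> spanned y -> spanned (x ** y).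
Proof.
move=> [s [hs ->]] [t [ht ->]]; rewrite nmul_suml; apply: spanned_sum => i si.
rewrite nmul_sumr; apply: spanned_sum => j tj.
rewrite -nscaleAl -nscaleAr; do 2 apply: spannedZ.
move: (hs _ si) (ht _ tj) => {si tj}; move: i j => [_ [a b]] [_ [c d]] /= ab cd.
rewrite -nmulA [T b ** _]nmulA TSE nmul_suml nmul_sumr.
apply: spanned_sum => -[p q] /in_Lmin[/= bp cq e _].
rewrite -[_ ** T d]nmulA TM -?cd // nmulA SM ?ab //.
by apply: spannedST; rewrite !ksrc_comp ?ab -?cd // -(ksrc_comp bp) e ksrc_comp.
Qed.

End KPFamily.

(** * Separation of paths and compression to a vertex *)

Lemma compatible_comp {k : nat} {L : kgraph k} (a b c d : L) :
  ksrc a = krng c -> ksrc b = krng d ->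
  compatible (kcomp a c) (kcomp b d) -> compatible a b.
Proof.
move=> ac bd /(compatible_pre (pre_comp ac))/compatible_sym.
by move=> /(compatible_pre (pre_comp bd))/compatible_sym.
Qed.

(** Induction on [s]: a further extension [u] separates [g] from the next path and cannot undo
    earlier separations, since compatibility passes to initial segments. The prescribed [c] will be
    the direction that avoids the bad terms. *)
Lemma aperiodic_separates_seq {k : nat} {L : kgraph k} (s : seq L) (g c : L) :
  finitely_aligned L -> aperiodic L -> ksrc g = krng c ->
  (forall d, d \in s -> ksrc d = ksrc g) ->
  exists2 t, ksrc c = krng t & forall d, d \in s -> d <> g ->
    ~ compatible (kcomp g (kcomp c t)) (kcomp d (kcomp c t)).
Proof.
move=> L_fa L_ap gc; elim: s => [_|d s IH sg].
  by exists (kid (ksrc c)); rewrite ?krng_id.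
have [e es|t ct ht] := IH; first by apply: sg; rewrite inE es orbT.
have [->|dg] := eqVneq d g.
  by exists t => // e; rewrite inE => /predU1P[->|/ht].
have dgs : ksrc d = ksrc g by apply: sg; rewrite mem_head.
have gct : ksrc g = krng (kcomp c t) by rewrite krng_comp.
have dct : ksrc d = krng (kcomp c t) by rewrite dgs.
have [||u tu nu] := @aperiodic_separates _ _
  (kcomp g (kcomp c t)) (kcomp d (kcomp c t)) L_fa L_ap.
- by rewrite !ksrc_comp.
- by move=> /(kcompIr gct dct) e; rewrite e eqxx in dg.
rewrite !ksrc_comp // in tu.
exists (kcomp t u); first by rewrite krng_comp.
have ctu : ksrc (kcomp c t) = krng u by rewrite ksrc_comp.
have E f : ksrc f = ksrc g -> kcomp f (kcomp c (kcomp t u)) = kcomp (kcomp f (kcomp c t)) u.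
  move=> fg; have fct : ksrc f = krng (kcomp c t) by rewrite krng_comp // fg.
  by rewrite -(kcompA fct ctu) -(kcompA ct tu).
have su f : ksrc f = ksrc g -> ksrc (kcomp f (kcomp c t)) = krng u.
  by move=> fg; rewrite ksrc_comp // fg gct.
move=> e; rewrite inE => /predU1P[->|es] eg; first by rewrite !E.
have egs : ksrc e = ksrc g by apply: sg; rewrite inE es orbT.
by rewrite !E // => /(compatible_comp (su _ erefl) (su _ egs)); apply: ht.
Qed.

(** Several terms may yield the same path; grouping them gives the one coefficient whose vanishing
    matters. *)
Lemma sum_collect {R : pzRingType} {V : lmodType R} (I J : eqType) (s : seq I)
    (P : pred I) (c : I -> R) (g : I -> J) (h : J -> V) :
  \sum_(i <- s | P i) c i *: h (g i) =
  \sum_(j <- undup (map g s)) (\sum_(i <- s | P i && (g i == j)) c i) *: h j.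
Proof.
under [RHS]eq_bigr do rewrite scaler_suml.
rewrite (exchange_big_dep P) /= => [|j i _ /andP[]//].
rewrite big_seq_cond [RHS]big_seq_cond; apply: eq_bigr => i /andP[si Pi].
rewrite big_mkcond (bigD1_seq (g i)) ?undup_uniq ?mem_undup ?map_f //= Pi eqxx.
by rewrite big1 ?addr0 // => j; rewrite eq_sym => /negPf ->.
Qed.

Section Compression.
Context {k : nat} {L : kgraph k} {R : fieldType} {A : nalgType R} {S T : L -> A}.
Hypothesis L_fa : finitely_aligned L.
Hypothesis L_ap : aperiodic L.
Hypothesis kp : kp_family S T.
Implicit Types (v w : kobj L) (a b c g l m n : L) (x y z : A).

Definition settled x l b := compatible b l -> pre b l \/
  forall p, Lmin b l p -> x ** S (kcomp l p.2) = 0.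

(** A minimal common extension of [b] and [l m] passes through one of [b] and [l], on which [x]
    already vanishes. *)
Lemma settled_comp x l b m : ksrc l = krng m -> settled x l b -> settled x (kcomp l m) b.
Proof.
move=> lm h bl; case: h.
- by apply/compatible_sym; apply: compatible_pre (pre_comp lm) _; apply/compatible_sym.
- by move=> h; left; apply: pre_trans (pre_comp lm).
move=> h; right=> -[p q] [/= bp lmq e _]; rewrite ksrc_comp // in lmq.
rewrite /= -(kcompA lm lmq) in e *.
have lmq' : ksrc l = krng (kcomp m q) by rewrite krng_comp.
have [[p1 q1] [pq1 [z pz /= [_ ->]]]] := compatible_Lmin bp lmq' e.
have [/= _ lq1 _ _] := pq1; have /= p1q1 := Lmin_src pq1; rewrite /= p1q1 in pz.
by rewrite kcompA // -(SM kp) ?ksrc_comp // nmulA (h _ pq1) nmul0r.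
Qed.

(** Induction on [s]: if [x] survives on a minimal common extension of [b] and the current path,
    move there, so that [b] becomes an initial segment; otherwise [b] is settled already. *)
Lemma exists_settled x (s : seq L) l : x ** S l <> 0 ->
  exists2 m, ksrc l = krng m & x ** S (kcomp l m) <> 0 /\
    forall b, b \in s -> settled x (kcomp l m) b.
Proof.
move=> xl; elim: s => [|b s [m lm [xm IH]]].
  by exists (kid (ksrc l)); rewrite ?krng_id // kcompl1.
have [[[p q] [bp xpq]]|no] :=
    pselect (exists p, Lmin b (kcomp l m) p /\ x ** S (kcomp (kcomp l m) p.2) <> 0).
  have [/= bp' lq e _] := bp; have mq : ksrc m = krng q by rewrite -lq ksrc_comp.
  exists (kcomp m q); first by rewrite krng_comp.
  rewrite kcompA //; split=> // c; rewrite inE => /predU1P[->|/IH].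
    by move=> _; left; exists p.
  exact: settled_comp.
exists m => //; split=> // c; rewrite inE => /predU1P[->|/IH//].
move=> _; right=> p bp; apply: contrapT => xp; apply: no.
by exists p.
Qed.

Theorem compression x : spanned (S := S) (T := T) x -> x <> 0 ->
  exists y z v, y ** x ** z = S (kid v).
Proof.
move=> [s [ss xE]] x0.
have [l0 xl0] : exists l, x ** S l <> 0.
  apply: contrapT => no; apply: x0.
  apply: (ghost_span_eq0 L_fa kp (s := undup [seq i.2.2 | i <- s])) => [|n _].
    rewrite xE big_seq; apply: ghost_span_sum => i si; rewrite nscaleAl.
    apply: mem_ghost_span; first exact: undup_uniq.
    by rewrite mem_undup; apply/mapP; exists i.
  by apply: contrapT => xn; apply: no; exists n.
have [m lm [xl' hs]] := exists_settled [seq i.2.2 | i <- s] xl0.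
set l := kcomp l0 m in xl' hs; move: l xl' hs => l xl hs {l0 xl0 m lm}.
pose w := ksrc l; pose y := x ** S l.
have yw : y ** S (kid w) = y by rewrite /y -nmulA (S_src kp).
(* [G] collects the tails of [l] in its minimal common extensions with the bad [b], those that are
   not initial segments of [l]. *)
pose G : set L := \bigcup_(b in [set b | b \in [seq i.2.2 | i <- s] /\ ~ pre b l])
  [set p.2 | p in Lmin b l].
have fG : finite_set G.
  apply: bigcup_finite => [|b _]; last exact: finite_image.
  apply: (sub_finite_set (B := [set` [seq i.2.2 | i <- s]])); last exact: finite_seq.
  by move=> b [].
have yG n : G n -> y ** S n = 0.
  move=> [b [bs nbl] [[p q] pq /= <-]].
  have bl : compatible b l by apply/compatibleP; exists (p, q).
  have [//|h] := hs _ bs bl; have [/= _ lq _ _] := pq.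
  by rewrite /y -nmulA (SM kp) // (h _ pq).
have rG n : G n -> krng n = w.
  by move=> [b _ [[p q] [/= _ lq _ _] <-]].
(* If every path at [w] met [G], then [G] would be exhaustive and [y], which annihilates it, would
   be 0. *)
have [t tw tG] : exists2 t, krng t = w & forall n, G n -> ~ compatible t n.
  apply: contrapT => no; apply: (xl).
  have eG : exhaustive w G.
    apply/exhaustiveP => t tw; apply: contrapT => h; apply: no; exists t => // n Gn tn.
    by apply: h; exists n.
  have nG : ~ G (kid w) by move=> /yG; rewrite yw.
  apply: (exhaustive_annihilates kp (FE_fset_set fG eG rG nG)) => // n.
  by rewrite in_fset_set // inE; apply: yG.
pose P (i : R * (L * L)) := `[< pre i.2.2 l >].
have hq (i : R * (L * L)) : exists q, P i -> ksrc i.2.2 = krng q /\ kcomp i.2.2 q = l.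
  rewrite /P; case: asboolP => [[q bq e]|_]; first by exists q.
  by exists l.
have [q qP] := choice hq.
(* With [l = b q], the term [S_a S_b^* S_l] reduces to the single path [a q]. *)
pose g i := kcomp i.2.1 (q i).
have agree i : i \in s -> P i -> ksrc i.2.1 = krng (q i) /\ ksrc (g i) = w.
  move=> si Pi; have [bq e] := qP _ Pi.
  by rewrite /g ksrc_comp ?ss //; split=> //; rewrite /w -e ksrc_comp.
pose C j := \sum_(i <- s | P i && (g i == j)) i.1.
have termE i : i \in s -> P i -> (i.1 *: (S i.2.1 ** T i.2.2)) ** S l = i.1 *: S (g i).
  move=> si Pi; have [bq e] := qP _ Pi; have [aq _] := agree _ si Pi.
  by rewrite -nscaleAl -nmulA -{1}e (TS_comp kp) // (SM kp).
(* If all [C j] vanished, only bad terms would remain; then [y] would lie in the ghost span of [G],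
   and [yG] would make it 0. *)
have [g0 g0s Cg0] : exists2 j, j \in undup (map g s) & C j <> 0.
  apply: contrapT => no; apply: xl.
  apply: (ghost_span_eq0 L_fa kp (s := enum_fset (fset_set G))); last first.
    by move=> n; rewrite [_ \in _]in_fset_set // inE; apply: yG.
  rewrite xE nmul_suml (bigID P) /=.
  rewrite big_seq_cond (eq_bigr (fun i => i.1 *: S (g i))); last first.
    by move=> i /andP[]; apply: termE.
  rewrite -big_seq_cond sum_collect big1_seq ?add0r => [|j /andP[_ js]]; last first.
    have [Cj|/eqP Cj] := eqVneq (C j) 0; first by rewrite -/(C j) Cj scale0r.
    by case: no; exists j.
  rewrite big_seq_cond; apply: ghost_span_sum => i /andP[si nPi].
  rewrite -nscaleAl -nmulA nscaleAl (TSE kp) nmul_sumr big_seq.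
  apply: ghost_span_sum => p pi; rewrite nmulA; apply: mem_ghost_span; first exact: fset_uniq.
  rewrite [_ \in _]in_fset_set // inE; exists i.2.2; last first.
    by exists p => //; apply: in_Lmin.
  by split; [apply/mapP; exists i|apply/asboolPn].
pose Gam := [seq j <- undup (map g s) | ksrc j == w].
have Cw j : ksrc j <> w -> C j = 0.
  move=> jw; rewrite /C big_seq_cond big1 // => i /andP[si /andP[Pi /eqP gi]].
  by case: jw; rewrite -gi; have [] := agree _ si Pi.
have g0w : ksrc g0 = w by apply: contrapT => /Cw.
have [|d|u tu hu] := @aperiodic_separates_seq _ _ Gam g0 t L_fa L_ap.
- by rewrite tw.
- by rewrite mem_filter g0w => /andP[/eqP].
pose t' := kcomp t u.
have tw' : krng t' = w by rewrite krng_comp.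
(* The bad terms disappear: a common extension of a bad [b] with [l t'] would give a tail in [G]
   compatible with [t]. *)
have yE : y ** S t' = \sum_(j <- undup (map g s)) C j *: S (kcomp j t').
  rewrite -sum_collect /y xE nmul_suml nmul_suml (bigID P) /=.
  rewrite addrC big1_seq ?add0r => [|i /andP[nPi si]]; last first.
    rewrite -nscaleAl -nscaleAl -!nmulA (SM kp) // (TS0 L_fa kp) ?nmulr0 ?scaler0 //.
    move=> [c [d bd <-] [z ltz e]]; rewrite ksrc_comp // in ltz.
    rewrite -kcompA // in e.
    have lt'z : ksrc l = krng (kcomp t' z) by rewrite krng_comp.
    have [[p1 q1] [pq [z' qz /= [_ eq]]]] := compatible_Lmin bd lt'z (esym e).
    rewrite (Lmin_src pq) /= in qz.
    apply: (tG q1); last first.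
      exists (kcomp t' z); last by rewrite eq; apply: pre_comp.
      by apply: pre_trans (pre_comp ltz); apply: pre_comp.
    exists i.2.2; last by exists (p1, q1).
    by split; [apply/mapP; exists i|apply/asboolPn].
  rewrite big_seq_cond [RHS]big_seq_cond; apply: eq_bigr => i /andP[si Pi].
  have [_ gw] := agree _ si Pi.
  by rewrite termE // -nscaleAl (SM kp) // gw.
exists ((C g0)^-1 *: T (kcomp g0 t')), (S l ** S t'), (ksrc t').
rewrite -nmulA [x ** _]nmulA -/y yE -nscaleAl nmul_sumr.
have g0t : ksrc g0 = krng t' by rewrite g0w.
rewrite (bigD1_seq g0) ?undup_uniq //= -nscaleAr (TS_self kp) ksrc_comp //.
rewrite big1_seq ?addr0 ?scalerA ?mulVf ?scale1r // => [|j /andP[/eqP jg0 js]].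
  exact/eqP.
rewrite -nscaleAr; have [jw|jw] := eqVneq (ksrc j) w; last first.
  by rewrite Cw ?scale0r //; apply/eqP.
by rewrite (TS0 L_fa kp) ?scaler0 //; apply: hu => //; rewrite mem_filter jw eqxx.
Qed.

End Compression.

(** * Simplicity and pure infiniteness *)

Section Idempotents.
Context {R : comPzRingType} {A : nalgType R}.
Implicit Types e x y : A.

(** With [f = x y], the module [eA] is the direct sum of [fA] and [(e - f)A], and left
    multiplication by [x] maps [eA] bijectively onto [fA], which is proper because [f] differs from
    [e]. *)
Lemma infinite_idempotentP e x y : e ** e = e -> e ** x = x -> y ** e = y ->
  x ** e = x -> y ** x = e -> x ** y <> e -> infinite_idempotent e.
Proof.
move=> ee ex ye xe yx xy; split=> //=.
have [f fE] : {f | f = x ** y} by exists (x ** y).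
have ff : f ** f = f by rewrite fE -nmulA [y ** _]nmulA yx nmulA xe.
have ef : e ** f = f by rewrite fE nmulA ex.
have fe : f ** e = f by rewrite fE -nmulA ye.
have rid g : right_ideal [set g ** a | a in setT].
  split; first by exists 0; rewrite ?nmulr0.
    by move=> _ _ [a _ <-] [b _ <-]; exists (a - b); rewrite ?nmulBr.
  by move=> _ a [b _ <-]; exists (b ** a); rewrite ?nmulA.
exists [set f ** a | a in setT], [set (e - f) ** a | a in setT]; split.
- split=> //.
    apply/seteqP; split=> [_ [[a _ <-] [b _ eb]]|_ ->]; last first.
      by split; [exists 0|exists 0]; rewrite ?nmulr0.
    have := congr1 (nmul f) eb.
    by rewrite !nmulA nmulBr ff fe subrr nmul0r => <-.
  apply/seteqP; split=> [_ [a _ <-]|_ [_ [a _ <-] [_ [b _ <-] <-]]].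
    exists (f ** a); first by exists a.
    exists ((e - f) ** a); first by exists a.
    by rewrite -nmulDl addrCA subrr addr0.
  exists (f ** a + (e - f) ** b) => //.
  by rewrite nmulDr !nmulA nmulBr ee ef.
- move=> fA; have : [set f ** a | a in setT] e by rewrite fA; exists e.
  move=> [a _ fa]; apply: xy; by rewrite -fE -[LHS]fe -fa nmulA ff.
- exists (nmul x); split=> [a b _ _|a b _|_ _ [a _ <-] [b _ <-] h|].
  + by rewrite nmulDr.
  + by rewrite nmulA.
  + by have := congr1 (nmul y) h; rewrite !nmulA yx ee.
  + apply/seteqP; split=> [_ [_ [a _ <-] <-]|_ [a _ <-]].
      by exists (x ** a) => //; rewrite fE -nmulA [y ** _]nmulA yx !nmulA xe.
    exists (e ** (y ** a)); first by exists (y ** a).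
    by rewrite nmulA xe fE nmulA.
Qed.

(** [b] and [q] implement an equivalence of [p] with [q b]; the proper isometry [u] of [p] is
    carried to [q u b]. *)
Lemma infinite_idempotent_equiv (p b q u u' : A) : p ** p = p -> b ** q = p ->
  q ** p = q -> p ** b = b -> p ** u = u -> u ** p = u -> p ** u' = u' ->
  u' ** p = u' -> u' ** u = p -> u ** u' <> p -> infinite_idempotent (q ** b).
Proof.
move=> pp bq qp pb pu up pu' u'p u'u uu'.
have bqA z : b ** (q ** z) = p ** z by rewrite nmulA bq.
have pA z w : p ** z = z -> p ** (z ** w) = z ** w by move=> pz; rewrite nmulA pz.
apply: (@infinite_idempotentP _ (q ** u ** b) (q ** u' ** b)); rewrite -!nmulA ?bqA.
- by rewrite pb.
- by rewrite pA.
- by rewrite pb.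
- by rewrite pb.
- by rewrite pA // [u' ** (u ** b)]nmulA u'u pb.
- rewrite pA // => h; apply: uu'.
  have := congr1 (fun z => b ** z ** q) h.
  by rewrite -!nmulA !bqA !bq u'p pp nmulA pu.
Qed.

End Idempotents.

Section GeneralizedCycles.
Context {k : nat} {L : kgraph k} {R : comPzRingType} {A : nalgType R} {S T : L -> A}.
Hypothesis L_fa : finitely_aligned L.
Hypothesis kp : kp_family S T.

(** The difference of the two sides is killed by every [S_a] with [m a] in [MCE m n], and the cycle
    condition makes these [a] exhaustive at [s(m)]. Hence [T m ** S n] is a left inverse of
    [T n ** S m]. *)
Lemma gcycle_absorb m n : generalized_cycle m n -> S n ** (T n ** S m) = S m.
Proof.
move=> [_ _ _ gc]; apply/esym/subr0_eq.
set x := _ - _; pose E : set L := [set p.1 | p in Lmin m n].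
have xE a : E a -> x ** S a = 0.
  move=> [[a' b] [/= ma nb e _] <- {a}].
  by rewrite /x nmulBl -!nmulA (SM kp) // e (TS_comp kp) // (SM kp) ?subrr.
have xs : x ** S (kid (ksrc m)) = x by rewrite /x nmulBl -!nmulA (S_src kp).
have [E1|nE1] := pselect (E (kid (ksrc m))); first by rewrite -xs xE.
have fE : finite_set E by apply: finite_image.
have eE : exhaustive (ksrc m) E.
  apply/exhaustiveP => t mt; have [c [d mtd <-] [b nb e]] := (compatible_MCE _ _).2 (gc _ mt).
  rewrite ksrc_comp // in mtd; rewrite -kcompA // in e.
  have [|p [pmn [z pz [ep _]]]] := compatible_Lmin _ nb (esym e); first by rewrite krng_comp.
  exists p.1; first by exists p.
  by exists (kcomp p.1 z); [rewrite -ep; apply: pre_comp|apply: pre_comp].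
have rE a : E a -> krng a = ksrc m by move=> [p [? _ _ _] <-].
apply: (exhaustive_annihilates kp (FE_fset_set fE eE rE nE1) xs) => a.
by rewrite in_fset_set // inE; apply: xE.
Qed.

(** Equality would give [S_t = S_n^* S_m S_m^* S_(n t)], which is 0 since [m] and [n t] have no
    common extension. *)
Lemma entrance_proper m n t : (forall v, S (kid v) <> 0) -> ksrc m = ksrc n ->
  entrance m n t -> T n ** S m ** (T m ** S n) <> S (kid (ksrc m)).
Proof.
move=> S0 smn [nt ent] h; apply: (S0 (ksrc t)).
rewrite -(TS_self kp) -(S_rng kp t) nt -smn -h -!nmulA (SM kp) //.
rewrite (TS0 L_fa kp) ?nmulr0 // => /compatible_MCE.
by rewrite ent => -[].
Qed.

End GeneralizedCycles.

Section Ideals.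
Context {k : nat} {L : kgraph k} {R : comPzRingType}.
Hypothesis L_fa : finitely_aligned L.
Local Notation A := (kp_algebra R L).
Local Notation S := (@kp_s R k L).
Local Notation T := (@kp_t R k L).
Let kp := @kp_universal_family R k L.

Lemma kp_spanned (x : A) : spanned (S := S) (T := T) x.
Proof.
elim/kp_ind: x; elim=> [l|l||t IHt u IHu|c t IHt|t IHt u IHu].
- exact: (spannedS kp).
- exact: (spannedT kp).
- exact: spanned0.
- by rewrite kp_piD; apply: spannedD.
- by rewrite kp_piZ; apply: spannedZ.
- by rewrite kp_piM; apply: (spannedM L_fa kp).
Qed.

Lemma kp_s_neq0 v : (1 : R) != 0 -> S (kid v) <> 0.
Proof.
move=> R1 s0; have bf := boundary_family R L_fa.
have [lS _] := kp_lift_gen bf; have [lD _ _] := kp_lift_hom bf.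
apply: (@S_rep_neq0 _ _ R L_fa R1 v); rewrite -lS s0.
by apply: (addrI (kp_lift (S_rep R (L:=L)) (T_rep R (L:=L)) 0)); rewrite -lD !addr0.
Qed.

Variable I : set A.
Hypothesis idI : ideal I.

Lemma idealD x y : I x -> I y -> I (x + y).
Proof.
move=> Ix Iy; have [[I0 IB _] _] := idI.
by rewrite -[y]opprK -[- y]sub0r; apply: (IB) => //; apply: IB.
Qed.

Lemma idealMr x y : I x -> I (x ** y).
Proof. by have [[_ _ h] _] := idI; apply: h. Qed.

Lemma idealMl x y : I y -> I (x ** y).
Proof. by have [_ h] := idI; apply: h. Qed.

Lemma ideal_hereditary l : I (S (kid (krng l))) -> I (S (kid (ksrc l))).
Proof.
by move=> h; rewrite -(TS_self kp) -{1}(T_rng kp) -nmulA; apply/idealMl/idealMr.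
Qed.

(** Modulo [I] each [S_m S_m^*] vanishes, so the product in (KP4), which is 0, is congruent to
    [s_v]. *)
Lemma ideal_saturated v E : FE v E -> (forall m, m \in E -> I (S (kid (ksrc m)))) ->
  I (S (kid v)).
Proof.
move=> vE IE.
have mE m : m \in enum_fset E -> I (S m ** T m).
  by move=> /IE h; rewrite -(S_src kp m); apply/idealMr/idealMl.
have h (s : seq L) x : (forall m, m \in s -> I (S m ** T m)) -> I (S (kid v) - x) ->
    I (S (kid v) - foldl nmul x [seq S (kid v) - S m ** T m | m <- s]).
  elim: s x => //= m s IH x Is Ix; apply: IH => [n ns|].
    by apply: Is; rewrite inE ns orbT.
  have -> : S (kid v) - x ** (S (kid v) - S m ** T m) =
      (S (kid v) - x) ** S (kid v) + x ** (S m ** T m).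
    by rewrite nmulBr nmulBl (Sid kp) opprB addrA addrAC.
  by apply: idealD; [apply: idealMr|apply/idealMl/Is; rewrite mem_head].
have [_ [_ _ _ /(_ _ _ vE)]] := kp.
have [m0 Em0 _] := (FE_exhaustive vE) _ (krng_id v).
have {Em0} : m0 \in enum_fset E by [].
case: (enum_fset E) mE => //= m s Is _ e.
have := h s (S (kid v) - S m ** T m); rewrite e subr0; apply.
  by move=> n ns; apply: Is; rewrite inE ns orbT.
by rewrite opprB addrC subrK; apply: Is; rewrite mem_head.
Qed.

Lemma ideal_setT : (forall v, I (S (kid v))) -> I = setT.
Proof.
move=> Iv; apply/seteqP; split=> // x _.
(* An ideal is not assumed closed under scalars, so the induction carries a scalar and absorbs it
   into a factor. *)
suff h c : I (c *: x) by rewrite -[x]scale1r.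
elim/kp_ind: x c; elim=> [l|l||t IHt u IHu|d t IHt|t IHt u IHu] c.
- by rewrite -[kp_pi _]/(S l) -(S_rng kp) nscaleAr; apply: idealMr.
- by rewrite -[kp_pi _]/(T l) -(T_src kp) nscaleAr; apply: idealMr.
- by rewrite kp_pi0 scaler0; have [[]] := idI.
- by rewrite kp_piD scalerDr; apply: idealD.
- by rewrite kp_piZ scalerA.
- by rewrite kp_piM nscaleAl; apply: idealMr.
Qed.

Lemma cofinal_ideal v : cofinal L -> I (S (kid v)) -> I = setT.
Proof.
move=> L_cof Iv; apply: ideal_setT => w; apply: contrapT => nw.
have [||F [tF _ hF]] := @tight_exists _ L L_fa (fun l => ~ I (S (kid (ksrc l)))) w.
- by rewrite ksrc_id.
- move=> l E nl lE; apply: contrapT => no; apply: nl; apply: (ideal_saturated lE) => m Em.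
  have [rm _] := lE.1 _ Em.
  apply: contrapT => nm; apply: no; exists m => //; by rewrite ksrc_comp.
have [a Fa [l [lv la]]] := cofinal_tight v L_cof tF.
(* Some extension [c = a b] in [F] has its source outside [I], while heredity along [l] and then [b]
   puts it inside. *)
have [c [b ab e] [_]] := hF _ Fa; apply.
rewrite -e ksrc_comp //; apply: ideal_hereditary; rewrite -ab -la.
by apply: ideal_hereditary; rewrite lv.
Qed.

End Ideals.

Theorem theorem5p4 (k : nat) (k_gt0 : (0 < k)%N) (L : kgraph k)
  (L_nonempty : inhabited (kobj L))
  (L_fa : finitely_aligned L)
  (R : fieldType)
  (L_aper : aperiodic L) (L_cof : cofinal L)
  (L_reach : forall v : kobj L, exists m n t : L,
     generalized_cycle m n /\ entrance m n t /\ reached_from v m n) :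
  simple_ring (kp_algebra R L) /\ purely_infinite (kp_algebra R L).
Proof.
pose S := @kp_s R k L; pose T := @kp_t R k L.
have kp : kp_family S T := kp_universal_family R L.
have Sv v : S (kid v) <> 0 by apply: kp_s_neq0 => //; apply: oner_neq0.
have core (x : kp_algebra R L) : x <> 0 -> exists y z v, y ** x ** z = S (kid v).
  by apply: (compression L_fa L_aper kp); apply: (kp_spanned L_fa).
split; first split.
- have [v] := L_nonempty; exists (S (kid v)), (S (kid v)).
  by rewrite (Sid kp).
- move=> I idI; have [[x [Ix x0]]|no] := pselect (exists x, I x /\ x <> 0).
    have [y [z [v e]]] := core _ x0; right; apply: (cofinal_ideal L_fa idI (v := v)) => //.
    by rewrite -[kp_s R (kid v)]/(S (kid v)) -e; apply/(idealMr idI)/(idealMl idI).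
  left; apply/seteqP; split=> [x Ix|_ ->]; last by have [[]] := idI.
  by apply: contrapT => x0; apply: no; exists x.
move=> I [I0 IB IM] InZ.
have [x [Ix x0]] : exists x, I x /\ x <> 0.
  apply: contrapT => no; apply: InZ; apply/seteqP; split=> [x Ix|_ -> //].
  by apply: contrapT => x0; apply: no; exists x.
have [y [z [v exz]]] := core _ x0.
have [m [n [t [[mn smn rmn gc] [[nt ent] [l [lv lm]]]]]]] := L_reach v.
pose p := S (kid (ksrc m)).
(* Conjugating [y x z = s_v] by [l], which leads from [v] to [s(m)], gives [p]; the last factor of
   [c] ensures [c p = c]. *)
pose b := T l ** y; pose c := z ** S l ** p.
have bxc : b ** x ** c = p.
  rewrite /b /c -!nmulA [y ** _]nmulA [y ** x ** _]nmulA exz.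
  by rewrite -lv [S (kid _) ** _]nmulA (S_rng kp) nmulA (TS_self kp) lm (Sid kp).
have bxc' : b ** (x ** c) = p by rewrite nmulA.
have cp : c ** p = c by rewrite /c -nmulA (Sid kp).
have pb : p ** b = b by rewrite /b nmulA /p -lm (T_src kp).
exists (x ** c ** b); first by rewrite -nmulA; apply: IM.
have pT a : ksrc a = ksrc m -> p ** T a = T a by rewrite /p => <-; apply: (T_src kp).
have Sp a : ksrc a = ksrc m -> S a ** p = S a by rewrite /p => <-; apply: (S_src kp).
apply: (@infinite_idempotent_equiv _ _ p b (x ** c) (T n ** S m) (T m ** S n)).
- exact: (Sid kp).
- exact: bxc'.
- by rewrite -nmulA cp.
- exact: pb.
- by rewrite nmulA pT.
- by rewrite -nmulA Sp.
- by rewrite nmulA pT.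
- by rewrite -nmulA Sp.
- by rewrite -nmulA (gcycle_absorb L_fa kp) // (TS_self kp).
- exact: (entrance_proper L_fa kp Sv smn (t := t)).
Qed.
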